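(* Let $X$ be a locally compact metrizable space, $\phi:X\to X$ a homeomorphism, and $\mathcal A=C_0(X)\times_\phi\mathbb Z_+$ the semicrossed product. The ideal generated by the compact elements of $\mathcal A$ is the set $$\{A\in\mathcal A : E_n(A)(X\setminus X_w)=\{0\} \text{ for all } n\in\mathbb Z_+,\ \text{and } E_0(A)(X_a)=\{0\}\}.$$
   Context: $\mathbb Z_+=\{0,1,2,\dots\}$. $X_a$ denotes the set of accumulation points of $X$. A subset $Y\subseteq X$ is called wandering if the sets $\phi^{-1}(Y),\phi^{-2}(Y),\dots$ are pairwise disjoint (equivalently, since $\phi$ is a homeomorphism, $\phi^m(Y)\cap\phi^n(Y)=\emptyset$ for all $m,n\in\mathbb Z_+$, $m\ne n$). A point $x\in X$ is wandering if it has an open wandering neighbourhood; $X_w$ denotes the set of wandering points of $X$. For $h\in C_0(X)$ and $Y\subseteq X$, the condition $h(Y)=\{0\}$ means that $h$ vanishes at every point of $Y$ (so it holds vacuously if $Y$ is empty). An element $A$ of $\mathcal A$ is called compact if the map $\mathcal A\to\mathcal A$, $T\mapsto ATA$, is a compact operator. Semicrossed product: $\mathbb Z_+$ acts on $C_0(X)$ (complex-valued continuous functions vanishing at infinity) by the isometric $*$-automorphisms $\alpha^n(f)=f\circ\phi^n$. The Banach space $\ell^1(\mathbb Z_+,C_0(X))$, whose elements are written as formal series $A=\sum_{n\in\mathbb Z_+}U^nf_n$ with norm $\sum_n\|f_n\|$, is a Banach algebra with the multiplication determined by $U^nf\,U^mg=U^{n+m}(\alpha^m(f)g)$. Let $C_0(X)$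 act faithfully on a Hilbert space $\mathcal H_0$. A faithful contractive representation $\pi$ of $\ell^1(\mathbb Z_+,C_0(X))$ on $\mathcal H_0\otimes\ell^2(\mathbb Z_+)$ is defined by $\pi(U^nf)(\xi\otimes e_k)=\alpha^k(f)\xi\otimes e_{k+n}$. The semicrossed product $\mathcal A=C_0(X)\times_\phi\mathbb Z_+$ is the operator-norm closure of the image of $\pi$; one writes $U^nf$ for $\pi(U^nf)$. Fourier coefficients: for $A=\sum_nU^nf_n\in\ell^1(\mathbb Z_+,C_0(X))$ put $E_n(A)=f_n$. The maps $E_n$ are contractive for the operator norm and extend to contractions $E_n:\mathcal A\to C_0(X)$; $E_n(A)$ is the $n$th Fourier coefficient of $A\in\mathcal A$. *)

(* Defs.v *)
From HB Require Import structures.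
From mathcomp Require Import all_boot all_order all_algebra.
From mathcomp Require Import complex.
From mathcomp Require Import all_classical all_reals all_analysis.
From mathcomp Require Import ring lra.

Set Implicit Arguments.
Unset Strict Implicit.
Unset Printing Implicit Defensive.

Import Order.TTheory GRing.Theory Num.Theory.
Import numFieldNormedType.Exports.

Local Open Scope classical_set_scope.
Local Open Scope ring_scope.
Local Open Scope complex_scope.

Section rnorm.
Context {R : realType} {V : normedModType R[i]}.
Implicit Types x y : V.

(* The norm of a complex normed module takes its values in R[i]; rnorm is the
   same norm with values in R. *)
Definition rnorm x : R := complex.Re `|x|.

Lemma rnormE x : `|x| = (rnorm x)%:C.
Proof.
by rewrite /rnorm; have := ger0_Im (normr_ge0 x); case: `|x| => a b /= ->.
Qed.

Lemma rnorm_ge0 x : 0 <= rnorm x.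
Proof. by rewrite -lecR -rnormE normr_ge0. Qed.

Lemma rnormD x y : rnorm (x + y) <= rnorm x + rnorm y.
Proof. by rewrite -lecR rmorphD /= -!rnormE ler_normD. Qed.

Lemma rnorm0 : rnorm (0 : V) = 0.
Proof. by apply: complexI; rewrite -rnormE normr0. Qed.

Lemma rnorm_eq0 x : rnorm x = 0 -> x = 0.
Proof. by move=> x0; apply/normr0_eq0; rewrite rnormE x0. Qed.

Lemma rnormB x y : rnorm (x - y) = rnorm (y - x).
Proof. by rewrite /rnorm distrC. Qed.

Lemma rnorm_continuous : continuous (rnorm : V -> R).
Proof.
move=> x; apply/cvgrPdist_lt => e e0; near=> y.
have xy : rnorm (x - y) < e.
  rewrite -ltcR -rnormE; near: y.
  by apply: (@cvgr_dist_lt _ _ _ (nbhs x)) => //; rewrite ltcR.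
apply: le_lt_trans xy; rewrite ler_norml; apply/andP; split.
  by rewrite rnormB lerNl opprB lerBlDr (le_trans _ (rnormD _ _))// subrK.
by rewrite lerBlDr (le_trans _ (rnormD _ _))// subrK.
Unshelve. all: by end_near. Qed.

End rnorm.

Lemma rnormZ {R : realType} {V : normedModType R[i]} (a : R[i]) (x : V) :
  rnorm (a *: x) = rnorm (a : R[i]^o) * rnorm x.
Proof. by apply: complexI; rewrite rmorphM /= -!rnormE normrZ. Qed.

Lemma rnormM {R : realType} (a b : R[i]^o) :
  rnorm (a * b : R[i]^o) = rnorm a * rnorm b.
Proof. exact: (@rnormZ R R[i]^o). Qed.

Lemma rnorm_conj {R : realType} (a : R[i]^o) :
  rnorm (Num.conj (a : R[i]) : R[i]^o) = rnorm a.
Proof. by rewrite /rnorm norm_conjC. Qed.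

Section C0.
Context (R : realType) (X : topologicalType).
Implicit Types f g : X -> R[i]^o.

Definition vanishing_at_infinity f :=
  forall e : R, 0 < e -> compact [set x | e <= rnorm (f x)].

Definition C0_pred : {pred X -> R[i]^o} :=
  [pred f | `[< continuous f /\ vanishing_at_infinity f >]].

Record C0 := MkC0 { C0_fun :> X -> R[i]^o ; _ : C0_fun \in C0_pred }.

HB.instance Definition _ := [isSub for C0_fun].
HB.instance Definition _ := [Choice of C0 by <:].

Lemma C0P (f : C0) : continuous f /\ vanishing_at_infinity f.
Proof. by case: f => f /= /asboolP. Qed.

Lemma rnorm_level_closed f e : continuous f -> closed [set x | e <= rnorm (f x)].
Proof.
move=> fc; apply: (@closed_comp _ _ (rnorm \o f) [set r | e <= r]).
  move=> x _; apply: continuous_comp; [exact: fc|exact: rnorm_continuous].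
exact: closed_ge.
Qed.

Fact C0_submod_closed : submod_closed C0_pred.
Proof.
split=> [|a f g /asboolP[fc f0] /asboolP[gc g0]]; apply/asboolP; split.
- by move=> x; apply: cvg_cst.
- move=> e e0; rewrite [X in compact X](_ : _ = set0); first exact: compact0.
  by rewrite -subset0 => x /=; rewrite rnorm0 leNgt e0.
- by move=> x; apply: cvgD; [apply: cvgZ; [exact: cvg_cst|exact: fc]|exact: gc].
move=> e e0; set A := rnorm (a : R[i]^o).
have A0 : 0 < A + 1 by rewrite ltr_wpDl ?rnorm_ge0.
pose d := e / 2 / (A + 1).
have d0 : 0 < d by rewrite !divr_gt0.
have e20 : 0 < e / 2 by rewrite divr_gt0.
apply: (@subclosed_compact _ _
    ([set x | d <= rnorm (f x)] `|` [set x | e / 2 <= rnorm (g x)])).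
- apply: rnorm_level_closed => x; apply: cvgD; last exact: gc.
  by apply: cvgZ; [exact: cvg_cst|exact: fc].
- by apply: compactU; [exact: f0|exact: g0].
move=> x /= ex; case: (leP (e / 2) (rnorm (g x))) => gx; [by right|left].
have := le_trans ex (rnormD _ _).
rewrite (rnormZ a (f x)) -/A => h.
rewrite /d ler_pdivrMr//; have := rnorm_ge0 (f x); nra.
Qed.

HB.instance Definition _ :=
  GRing.isSubmodClosed.Build R[i] (X -> R[i]^o) C0_pred C0_submod_closed.
HB.instance Definition _ := [SubChoice_isSubLmodule of C0 by <:].

Lemma C0_bounded (f : C0) : exists M, forall x, rnorm (f x) <= M.
Proof.
have [fc f0] := C0P f.
have /compact_bounded : compact ((rnorm \o f) @` [set x | 1 <= rnorm (f x)]).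
  apply: continuous_compact; last exact: f0.
  apply: continuous_subspaceT => x.
  by apply: continuous_comp; [exact: fc|exact: rnorm_continuous].
move=> /pinfty_ex_gt0[M M0 /= fM].
exists (Num.max 1 M) => x; rewrite le_max.
case: (leP (rnorm (f x)) 1) => //= /ltW f1.
by have /= := fM _ (ex_intro2 _ _ x f1 erefl); rewrite ger0_norm// rnorm_ge0.
Qed.

Definition sup_norm (f : C0) : R := sup [set rnorm (f x) | x in [set: X]].

Lemma sup_norm_ub (f : C0) x : rnorm (f x) <= sup_norm f.
Proof.
have [M fM] := C0_bounded f.
by apply: ub_le_sup; [exists M => _ [y _ <-]|exists x].
Qed.

Lemma sup_norm_le (f : C0) (M : R) :
  0 <= M -> (forall x, rnorm (f x) <= M) -> sup_norm f <= M.
Proof.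
move=> M0 fM; rewrite /sup_norm.
have [->|/set0P ne] := eqVneq [set rnorm (f x) | x in [set: X]] set0.
  by rewrite sup0.
by apply: ge_sup => // _ [x _ <-].
Qed.

Lemma sup_norm_ge0 (f : C0) : 0 <= sup_norm f.
Proof.
have [S0|/set0P[_ [x _ _]]] := eqVneq [set rnorm (f x) | x in [set: X]] set0.
  by rewrite /sup_norm S0 sup0.
exact: le_trans (rnorm_ge0 _) (sup_norm_ub f x).
Qed.

Let C0_norm (f : C0) : R[i] := (sup_norm f)%:C.

Let C0_normD (f g : C0) : C0_norm (f + g) <= C0_norm f + C0_norm g.
Proof.
rewrite /C0_norm -rmorphD /= lecR; apply: sup_norm_le.
  by rewrite addr_ge0 ?sup_norm_ge0.
by move=> x; rewrite (le_trans (rnormD _ _))// lerD// sup_norm_ub.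
Qed.

Let C0_normZ (a : R[i]) (f : C0) : C0_norm (a *: f) = `|a| * C0_norm f.
Proof.
rewrite /C0_norm (@rnormE _ R[i]^o a) -rmorphM /=; congr _%:C.
apply/eqP; rewrite eq_le; apply/andP; split.
  apply: sup_norm_le; first by rewrite mulr_ge0 ?sup_norm_ge0 ?rnorm_ge0.
  move=> x; rewrite [leLHS](rnormZ a (f x)).
  by rewrite ler_wpM2l ?rnorm_ge0 ?sup_norm_ub.
have [a0|a0] := eqVneq (rnorm (a : R[i]^o)) 0.
  by rewrite a0 mul0r sup_norm_ge0.
have {}a0 : 0 < rnorm (a : R[i]^o) by rewrite lt_def a0 rnorm_ge0.
rewrite mulrC -ler_pdivlMr//; apply: sup_norm_le.
  by rewrite divr_ge0 ?sup_norm_ge0 ?rnorm_ge0.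
move=> x; rewrite ler_pdivlMr// mulrC -(rnormZ a (f x)).
exact: (sup_norm_ub (a *: f)).
Qed.

Let C0_norm_eq0 (f : C0) : C0_norm f = 0 -> f = 0.
Proof.
move=> [f0]; apply/val_inj/funext => x; apply: rnorm_eq0; apply/eqP.
by rewrite eq_le rnorm_ge0 andbT -f0 sup_norm_ub.
Qed.

HB.instance Definition _ :=
  Lmodule_isNormed.Build R[i] C0 C0_normD C0_normZ C0_norm_eq0.

Fact C0_mul_subproof (f g : C0) : (fun x => f x * g x) \in C0_pred.
Proof.
have [[fc f0] [gc g0]] := (C0P f, C0P g).
have hc : continuous (fun x => f x * g x : R[i]^o).
  by move=> x; apply: (cvgZ (fc x) (gc x)).
apply/asboolP; split=> // e e0.
have [M gM] := C0_bounded g.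
have M0 : 0 < `|M| + 1 by rewrite ltr_wpDl.
apply: (subclosed_compact (rnorm_level_closed hc)).
  exact: (f0 (e / (`|M| + 1)) (divr_gt0 e0 M0)).
move=> x /=; rewrite rnormM => h; rewrite ler_pdivrMr//.
apply: (le_trans h); rewrite ler_wpM2l ?rnorm_ge0// (le_trans (gM x))//.
by rewrite (le_trans (ler_norm M))// lerDl.
Qed.
Definition C0_mul (f g : C0) : C0 := MkC0 (C0_mul_subproof f g).

Fact C0_conj_subproof (f : C0) :
  (fun x => Num.conj (f x : R[i]) : R[i]^o) \in C0_pred.
Proof.
have [fc f0] := C0P f; apply/asboolP; split=> [x|e e0].
  apply/cvgrPdist_lt => e e0; near=> y.
  rewrite -[X in `|X|]/(_ - _ : R[i]) -rmorphB norm_conjC.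
  by near: y; apply: (@cvgr_dist_lt _ _ _ (nbhs x)) => //; exact: fc.
under eq_set do rewrite rnorm_conj.
exact: f0.
Unshelve. all: by end_near. Qed.
Definition C0_conj (f : C0) : C0 := MkC0 (C0_conj_subproof f).

End C0.
Section BL.
Context {R : realType} (V : normedModType R[i]).
Implicit Types f g : V -> V.

Definition BL_pred : {pred V -> V} := [pred f | `[< linear f /\ continuous f >]].

Record BL := MkBL { BL_fun :> V -> V ; _ : BL_fun \in BL_pred }.

HB.instance Definition _ := [isSub for BL_fun].
HB.instance Definition _ := [Choice of BL by <:].

Lemma BLP (T : BL) : linear T /\ continuous T.
Proof. by case: T => T /= /asboolP. Qed.

Fact BL_submod_closed : submod_closed BL_pred.
Proof.
split=> [|a f g /asboolP[fl fc] /asboolP[gl gc]]; apply/asboolP; split.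
- by move=> b x y; rewrite -[LHS]/(0 : V) -[RHS]/(b *: 0 + 0 : V) scaler0 addr0.
- by move=> x; apply: cvg_cst.
- move=> b x y; rewrite -[LHS]/(a *: f (b *: x + y) + g (b *: x + y)).
  rewrite -[RHS]/(b *: (a *: f x + g x) + (a *: f y + g y)).
  by rewrite fl gl !scalerDr !scalerA [b * a]mulrC addrACA.
- by move=> x; apply: cvgD; [apply: cvgZ; [exact: cvg_cst|exact: fc]|exact: gc].
Qed.

HB.instance Definition _ :=
  GRing.isSubmodClosed.Build R[i] (V -> V) BL_pred BL_submod_closed.
HB.instance Definition _ := [SubChoice_isSubLmodule of BL by <:].

Let BLZ (T : BL) (a : R[i]) x : T (a *: x) = a *: T x.
Proof.
have [Tl _] := BLP T.
have T0 : T 0 = 0.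
  by have := Tl (-1) 0 0; rewrite scaler0 addr0 scaleN1r addNr.
by have := Tl a x 0; rewrite addr0 T0 addr0.
Qed.

Lemma BL_bounded (T : BL) : exists M, forall x, rnorm (T x) <= M * rnorm x.
Proof.
have [Tl Tc] := BLP T.
pose L : {linear V -> V} := HB.pack (T : V -> V) (GRing.isLinear.Build _ _ _ _ _ Tl).
have /linear_boundedP/pinfty_ex_gt0[M M0 /= TM] : bounded_near L (nbhs (0 : V)).
  exact/linear_bounded_continuous.
exists (complex.Re M) => x; rewrite -lecR rmorphM /= -!rnormE.
suff -> : (complex.Re M)%:C = M by exact: TM.
by have := ger0_Im (ltW M0); case: {TM M0} M => a b /= ->.
Qed.

Definition op_norm (T : BL) : R := sup [set rnorm (T x) | x in [set x | rnorm x <= 1]].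

Lemma op_norm_ub1 (T : BL) x : rnorm x <= 1 -> rnorm (T x) <= op_norm T.
Proof.
move=> x1; have [M TM] := BL_bounded T.
apply: ub_le_sup; last by exists x.
exists `|M| => _ [y /= y1 <-]; rewrite (le_trans (TM y))//.
have := rnorm_ge0 y; have := ler_norm M; have := normr_ge0 M; nra.
Qed.

Lemma op_norm_le (T : BL) (M : R) :
  (forall x, rnorm x <= 1 -> rnorm (T x) <= M) -> op_norm T <= M.
Proof.
move=> TM; apply: ge_sup; last by move=> _ [x x1 <-]; exact: TM.
by exists (rnorm (T 0)); exists 0 => //=; rewrite rnorm0.
Qed.

Lemma op_norm_ge0 (T : BL) : 0 <= op_norm T.
Proof.
by apply: le_trans (rnorm_ge0 _) (@op_norm_ub1 T 0 _); rewrite rnorm0.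
Qed.

Lemma op_norm_ub (T : BL) x : rnorm (T x) <= op_norm T * rnorm x.
Proof.
have [x0|x0] := eqVneq (rnorm x) 0.
  have [M TM] := BL_bounded T.
  by rewrite (le_trans (TM x))// x0 !mulr0.
have {}x0 : 0 < rnorm x by rewrite lt_def x0 rnorm_ge0.
rewrite -ler_pdivrMr//.
have h : rnorm ((rnorm x)^-1%:C : R[i]^o) = (rnorm x)^-1.
  by apply: complexI; rewrite -rnormE ger0_norm// lecR invr_ge0 ltW.
have := @op_norm_ub1 T ((rnorm x)^-1%:C *: x).
by rewrite BLZ !rnormZ h mulVf ?gt_eqF// mulrC; apply.
Qed.

Let BL_norm (T : BL) : R[i] := (op_norm T)%:C.

Let BL_normD (S T : BL) : BL_norm (S + T) <= BL_norm S + BL_norm T.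
Proof.
rewrite /BL_norm -rmorphD /= lecR; apply: op_norm_le => x x1.
by rewrite (le_trans (rnormD _ _))// lerD// op_norm_ub1.
Qed.

Let BL_normZ (a : R[i]) (T : BL) : BL_norm (a *: T) = `|a| * BL_norm T.
Proof.
rewrite /BL_norm (@rnormE _ R[i]^o a) -rmorphM /=; congr _%:C.
apply/eqP; rewrite eq_le; apply/andP; split.
  apply: op_norm_le => x x1; rewrite [leLHS](rnormZ a (T x)).
  by rewrite ler_wpM2l ?rnorm_ge0 ?op_norm_ub1.
have [a0|a0] := eqVneq (rnorm (a : R[i]^o)) 0.
  by rewrite a0 mul0r op_norm_ge0.
have {}a0 : 0 < rnorm (a : R[i]^o) by rewrite lt_def a0 rnorm_ge0.
rewrite mulrC -ler_pdivlMr//; apply: op_norm_le => x x1.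
rewrite ler_pdivlMr// mulrC -(rnormZ a (T x)).
exact: (op_norm_ub1 (a *: T)).
Qed.

Let BL_norm_eq0 (T : BL) : BL_norm T = 0 -> T = 0.
Proof.
move=> [T0]; apply/val_inj/funext => x; apply: rnorm_eq0; apply/eqP.
by rewrite eq_le rnorm_ge0 andbT (le_trans (op_norm_ub T x))// T0 mul0r.
Qed.

HB.instance Definition _ :=
  Lmodule_isNormed.Build R[i] BL BL_normD BL_normZ BL_norm_eq0.

Fact BL_comp_subproof (S T : BL) : S \o T \in BL_pred.
Proof.
have [[Sl Sc] [Tl Tc]] := (BLP S, BLP T); apply/asboolP; split.
  by move=> a x y /=; rewrite Tl Sl.
by move=> x; apply: continuous_comp; [exact: Tc|exact: Sc].
Qed.
Definition BL_comp (S T : BL) : BL := MkBL (BL_comp_subproof S T).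

End BL.

Section l2.
Context {R : realType} (H : normedModType R[i]).
Implicit Types u v : nat -> H.

Definition square_summable u := cvgn (series (fun n => rnorm (u n) ^+ 2)).

Definition l2_pred : {pred nat -> H} := [pred u | `[< square_summable u >]].

(* H (x) l^2(Z_+) is identified with the square-summable sequences in H, the
   elementary tensor xi (x) e_k being the sequence equal to xi at k and to 0
   elsewhere. *)
Record l2 := MkL2 { l2_fun :> nat -> H ; _ : l2_fun \in l2_pred }.

HB.instance Definition _ := [isSub for l2_fun].
HB.instance Definition _ := [Choice of l2 by <:].

Let psum u n : R := series (fun n => rnorm (u n) ^+ 2) n.

Let psumS u n : psum u n.+1 = psum u n + rnorm (u n) ^+ 2.
Proof. by rewrite /psum seriesEnat /= big_nat_recr. Qed.

Let psum0 u : psum u 0 = 0.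
Proof. by rewrite /psum seriesEnat /= big_geq. Qed.

Let psum_ge0 u n : 0 <= psum u n.
Proof. by rewrite /psum seriesEnat /= sumr_ge0// => i _; rewrite sqr_ge0. Qed.

Let psum_nd u : {homo psum u : m n / (m <= n)%N >-> m <= n}.
Proof.
apply/nondecreasing_seqP => n.
by rewrite psumS lerDl sqr_ge0.
Qed.

Let square_summableP u :
  (exists M, forall n, psum u n <= M) -> square_summable u.
Proof.
move=> [M uM]; apply: nondecreasing_is_cvgn; first exact: psum_nd.
by exists M => _ [n _ <-]; exact: uM.
Qed.

Let psum_le u n : square_summable u -> psum u n <= limn (psum u).
Proof. by move=> us; apply: nondecreasing_cvgn_le => //; exact: psum_nd. Qed.

Let minkowski2 (p q a b : R) :
  Num.sqrt ((p + q) ^+ 2 + (a + b) ^+ 2) <=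
  Num.sqrt (p ^+ 2 + a ^+ 2) + Num.sqrt (q ^+ 2 + b ^+ 2).
Proof.
set s := Num.sqrt (p ^+ 2 + _); set t := Num.sqrt (q ^+ 2 + _).
have s0 : 0 <= s := sqrtr_ge0 _; have t0 : 0 <= t := sqrtr_ge0 _.
have s2 : s ^+ 2 = p ^+ 2 + a ^+ 2 by rewrite sqr_sqrtr// addr_ge0 ?sqr_ge0.
have t2 : t ^+ 2 = q ^+ 2 + b ^+ 2 by rewrite sqr_sqrtr// addr_ge0 ?sqr_ge0.
rewrite -(ger0_norm (addr_ge0 s0 t0)) -sqrtr_sqr ler_sqrt ?sqr_ge0//.
rewrite [leRHS]sqrrD s2 t2.
suff : p * q + a * b <= s * t by nra.
apply: le_trans (ler_norm _) _.
rewrite -(ger0_norm (mulr_ge0 s0 t0)) -!sqrtr_sqr ler_sqrt ?sqr_ge0//.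
by rewrite [leRHS]exprMn s2 t2; have := sqr_ge0 (p * b - a * q); nra.
Qed.

Let psumD u v n :
  Num.sqrt (psum (u + v) n) <= Num.sqrt (psum u n) + Num.sqrt (psum v n).
Proof.
elim: n => [|n IHn]; first by rewrite !psum0 sqrtr0 addr0.
rewrite -(sqr_sqrtr (psum_ge0 u n)) -(sqr_sqrtr (psum_ge0 v n)) in IHn *.
rewrite !psumS.
rewrite -[X in _ <= Num.sqrt (X + _) + _](sqr_sqrtr (psum_ge0 u n)).
rewrite -[X in _ <= _ + Num.sqrt (X + _)](sqr_sqrtr (psum_ge0 v n)).
rewrite !sqrtr_sqr !(ger0_norm (sqrtr_ge0 _)) in IHn.
apply: le_trans (minkowski2 _ _ _ _).
rewrite ler_sqrt ?addr_ge0 ?sqr_ge0//; apply: lerD.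
  rewrite -[leLHS](sqr_sqrtr (psum_ge0 (u + v) n)).
  by rewrite ler_sqr// nnegrE ?addr_ge0 ?sqrtr_ge0.
by rewrite ler_sqr ?rnormD// nnegrE ?addr_ge0 ?rnorm_ge0.
Qed.

Let psumZ (a : R[i]) u n : psum (a *: u) n = rnorm (a : R[i]^o) ^+ 2 * psum u n.
Proof.
elim: n => [|n IHn]; first by rewrite !psum0 mulr0.
by rewrite !psumS IHn mulrDr -exprMn -rnormZ.
Qed.

Fact l2_submod_closed : submod_closed l2_pred.
Proof.
split=> [|a u v /asboolP us /asboolP vs]; apply/asboolP/square_summableP.
  exists 0; elim=> [|n IHn]; first by rewrite psum0.
  by rewrite psumS rnorm0 expr0n addr0.
exists ((rnorm (a : R[i]^o) * Num.sqrt (limn (psum u)) +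
         Num.sqrt (limn (psum v))) ^+ 2) => n.
rewrite -(sqr_sqrtr (psum_ge0 _ n)).
rewrite ler_sqr ?nnegrE ?addr_ge0 ?mulr_ge0 ?sqrtr_ge0 ?rnorm_ge0//.
apply: le_trans (psumD _ _ _) _; apply: lerD.
  rewrite psumZ sqrtrM ?sqr_ge0// sqrtr_sqr ger0_norm ?rnorm_ge0//.
  by rewrite ler_wpM2l ?rnorm_ge0// ler_wsqrtr// psum_le.
by rewrite ler_wsqrtr// psum_le.
Qed.

HB.instance Definition _ :=
  GRing.isSubmodClosed.Build R[i] (nat -> H) l2_pred l2_submod_closed.
HB.instance Definition _ := [SubChoice_isSubLmodule of l2 by <:].

Lemma l2P (u : l2) : square_summable u.
Proof. by case: u => u /= /asboolP. Qed.

Definition l2_rnorm (u : l2) : R :=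
  Num.sqrt (limn (series (fun n => rnorm (u n) ^+ 2))).

Let l2_rnorm_ub (u : l2) n : Num.sqrt (psum u n) <= l2_rnorm u.
Proof. by rewrite ler_wsqrtr// psum_le//; exact: l2P. Qed.

Let l2_rnorm_le (u : l2) (M : R) :
  (forall n, Num.sqrt (psum u n) <= M) -> l2_rnorm u <= M.
Proof.
move=> uM; have M0 : 0 <= M := le_trans (sqrtr_ge0 _) (uM 0%N).
rewrite /l2_rnorm -(ger0_norm M0) -sqrtr_sqr ler_wsqrtr//.
apply: limr_le; first exact: l2P.
apply: nearW => n; rewrite -[leLHS](sqr_sqrtr (psum_ge0 u n)).
by rewrite ler_sqr// nnegrE sqrtr_ge0.
Qed.

Let l2_norm (u : l2) : R[i] := (l2_rnorm u)%:C.

Let l2_normD (u v : l2) : l2_norm (u + v) <= l2_norm u + l2_norm v.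
Proof.
rewrite /l2_norm -rmorphD /= lecR; apply: l2_rnorm_le => n.
by rewrite (le_trans (psumD _ _ _))// lerD// l2_rnorm_ub.
Qed.

Let l2_normZ (a : R[i]) (u : l2) : l2_norm (a *: u) = `|a| * l2_norm u.
Proof.
rewrite /l2_norm (@rnormE _ R[i]^o a) -rmorphM /=; congr _%:C.
have sqrtZ n : Num.sqrt (psum (a *: u) n) =
               rnorm (a : R[i]^o) * Num.sqrt (psum u n).
  by rewrite psumZ sqrtrM ?sqr_ge0// sqrtr_sqr ger0_norm ?rnorm_ge0.
apply/eqP; rewrite eq_le; apply/andP; split.
  apply: l2_rnorm_le => n; rewrite [leLHS]sqrtZ.
  by rewrite ler_wpM2l ?rnorm_ge0 ?l2_rnorm_ub.
have [a0|a0] := eqVneq (rnorm (a : R[i]^o)) 0.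
  by rewrite a0 mul0r sqrtr_ge0.
have {}a0 : 0 < rnorm (a : R[i]^o) by rewrite lt_def a0 rnorm_ge0.
rewrite mulrC -ler_pdivlMr//; apply: l2_rnorm_le => n.
by rewrite ler_pdivlMr// mulrC -sqrtZ; exact: (l2_rnorm_ub (a *: u)).
Qed.

Let l2_norm_eq0 (u : l2) : l2_norm u = 0 -> u = 0.
Proof.
move=> [u0]; apply/val_inj/funext => n; apply: rnorm_eq0; apply/eqP.
have := l2_rnorm_ub u n.+1; rewrite u0 => un.
have : psum u n.+1 <= 0.
  by rewrite -sqrtr_eq0 eq_le un sqrtr_ge0.
rewrite psumS => h; rewrite -(sqrf_eq0 (rnorm _)) eq_le sqr_ge0 andbT.
by rewrite (le_trans _ h)// lerDr psum_ge0.
Qed.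

HB.instance Definition _ :=
  Lmodule_isNormed.Build R[i] l2 l2_normD l2_normZ l2_norm_eq0.

Fact tensor_subproof (xi : H) (k : nat) :
  (fun n => if n == k then xi else 0) \in l2_pred.
Proof.
apply/asboolP/square_summableP; exists (rnorm xi ^+ 2) => n.
have h m : psum (fun n => if n == k then xi else 0) m =
    if (k < m)%N then rnorm xi ^+ 2 else 0.
  elim: m => [|m IHm]; first by rewrite psum0.
  rewrite psumS IHm ltnS [(k <= m)%N]leq_eqVlt [m == k]eq_sym.
  have [->|km] := eqVneq k m; first by rewrite ltnn add0r.
  by rewrite rnorm0 expr0n addr0.
by rewrite h; case: ifP => // _; rewrite sqr_ge0.
Qed.
Definition tensor (xi : H) (k : nat) : l2 := MkL2 (tensor_subproof xi k).

End l2.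

Record homeomorphism (X : topologicalType) := Homeomorphism {
  homeo_fun :> X -> X ;
  homeo_inv : X -> X ;
  homeo_funK : cancel homeo_fun homeo_inv ;
  homeo_invK : cancel homeo_inv homeo_fun ;
  homeo_fun_continuous : continuous homeo_fun ;
  homeo_inv_continuous : continuous homeo_inv }.

Section dynamics.
Context {X : topologicalType} (phi : homeomorphism X).

Definition wandering_set (Y : set X) :=
  trivIset [set n | (0 < n)%N] (fun n => iter n phi @^-1` Y).

Definition wandering_points : set X :=
  [set x | exists2 V, open_nbhs x V & wandering_set V].

Definition accumulation_points : set X := limit_point [set: X].

Context {R : realType}.

Let iter_continuous (f : X -> X) n : continuous f -> continuous (iter n f).
Proof.
move=> fc; elim: n => [|n IHn] x /=; first exact: cvg_id.
by apply: continuous_comp; [exact: IHn|exact: fc].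
Qed.

Let iterK (f g : X -> X) n : cancel f g -> cancel (iter n f) (iter n g).
Proof. by move=> fK; elim: n => [|n IHn] x //=; rewrite -iterS iterSr fK. Qed.

Fact alpha_subproof n (f : C0 R X) : (fun x => f (iter n phi x)) \in @C0_pred R X.
Proof.
have [fc f0] := C0P f; apply/asboolP; split.
  move=> x; apply: continuous_comp; last exact: fc.
  exact/iter_continuous/homeo_fun_continuous.
move=> e e0.
rewrite (_ : [set x | _] =
    iter n (homeo_inv phi) @` [set y | e <= rnorm (f y)]); last first.
  apply/seteqP; split=> [x /= ex|_ [y /= ey <-]].
    by exists (iter n phi x) => //; rewrite (iterK _ (homeo_funK phi)).
  by rewrite (iterK _ (homeo_invK phi)).
apply: continuous_compact; last exact: f0.
exact/continuous_subspaceT/iter_continuous/homeo_inv_continuous.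
Qed.
Definition alpha n (f : C0 R X) : C0 R X := MkC0 (alpha_subproof n f).

End dynamics.

(* A faithful *-representation of C_0(X) on a Hilbert space H with inner
   product dotp; it is not required to be nondegenerate. *)
Record faithful_representation {R : realType} {X : topologicalType}
    {H : normedModType R[i]} (dotp : {dot H for Num.conj})
    (sigma : C0 R X -> BL H) : Prop := FaithfulRepresentation {
  rep_linear : linear sigma ;
  rep_mul : forall f g, sigma (C0_mul f g) = BL_comp (sigma f) (sigma g) ;
  rep_star : forall f xi eta,
    dotp (sigma f xi) eta = dotp xi (sigma (C0_conj f) eta) ;
  rep_faithful : injective sigma }.

Section semicrossed_product.
Context {R : realType} {X : topologicalType} (phi : homeomorphism X).
Context {H : normedModType R[i]} (sigma : C0 R X -> BL H).

Definition ell1 (F : nat -> C0 R X) := cvgn (series (fun n => rnorm (F n))).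

(* T = pi (\sum_n U^n F_n), that is,
   T (xi (x) e_k) = \sum_n alpha^k (F_n) xi (x) e_(k+n);
   Such a T is unique, being linear and continuous, and it exists for every F
   in ell1, because a *-representation sigma is contractive. *)
Definition represents (F : nat -> C0 R X) (T : BL (l2 H)) :=
  forall (xi : H) (k : nat),
    series (fun n => tensor (sigma (alpha phi k (F n)) xi) (k + n)%N) @ \oo -->
    T (tensor xi k).

Definition semicrossed_product : set (BL (l2 H)) :=
  closure [set T | exists2 F, ell1 F & represents F T].

(* E_n is the extension by continuity of the contraction
   pi (\sum_n U^n F_n) |-> F_n: its graph is the closure of the graph of the
   latter, so xget selects the only element of a singleton when T is in the
   semicrossed product. *)
Definition fourier_graph (n : nat) : set (BL (l2 H) * C0 R X) :=
  closure [set p | exists2 F, ell1 F & represents F p.1 /\ p.2 = F n].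

Definition fourier_coef (n : nat) (T : BL (l2 H)) : C0 R X :=
  xget 0 [set f | fourier_graph n (T, f)].

End semicrossed_product.

Section operator_algebra.
Context {R : realType} {V : normedModType R[i]} (A : set (BL V)).

Definition compact_element : set (BL V) :=
  [set S | A S /\ forall B : set (BL V), B `<=` A -> bounded_set B ->
    precompact [set BL_comp S (BL_comp T S) | T in B]].

(* Ideals are two-sided and norm closed; the set in the theorem is closed, and
   finite sums of products do not exhaust it in general (for instance for a
   translation of the real line). *)
Definition closed_ideal (J : set (BL V)) :=
  [/\ J `<=` A, closed J,
      J 0 /\ (forall (a : R[i]) S T, J S -> J T -> J (a *: S + T)) &
      forall S T, A S -> J T -> J (BL_comp S T) /\ J (BL_comp T S)].

Definition generated_ideal (S : set (BL V)) : set (BL V) :=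
  smallest closed_ideal S.

End operator_algebra.

(* Main.v *)
Require Import Defs.
From HB Require Import structures.
From mathcomp Require Import all_boot all_order all_algebra.
From mathcomp Require Import complex.
From mathcomp Require Import all_classical all_reals all_analysis.
From mathcomp Require Import finmap ring lra.

Import Order.TTheory GRing.Theory Num.Theory.
Import numFieldNormedType.Exports.

Local Open Scope classical_set_scope.
Local Open Scope ring_scope.
Local Open Scope complex_scope.

Set Implicit Arguments.
Unset Strict Implicit.
Unset Printing Implicit Defensive.

(** Why the theorem holds.

    An element T of the semicrossed product is determined by its Fourier
    coefficients F n: its matrix in l^2(Z_+, H) is lower triangular with entries
    alpha^k (F (i - k)) ([symbol]). Since a faithful representation of C_0(X) is
    isometric ([rep_contractive], [rep_isometric]), coefficients are contractive,
    survive norm limits, and agree with those defined by closing the graph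
    ([symbol_fourier]); products are given by convolution ([symbol_comp]). Hence
    the right-hand side of the theorem is a closed ideal
    ([vanishing_ideal_closed]): coefficients are continuous, and phi maps
    nonwandering points to nonwandering points.

    It contains the compact elements. If T is compact, the operators T (U^m f) T
    with f fixed form a precompact family, so that their coefficients of large
    index are uniformly small ([compact_element_vanishing]). At a point with
    arbitrarily long returns to its neighbourhoods ([nonwandering_recurrence]) the
    coefficient of index m + 2 n is close to a product of three values of F n, for
    the least n at which the coefficients of T do not vanish on the orbit; this
    forces F n to vanish there ([compact_nonwandering]). The functions (F 0)^2 f,
    for f in a ball, are the zeroth coefficients of the T f T; they are
    equicontinuous, which forces F 0 to vanish at accumulation points
    ([compact_accumulation]).

    Conversely, the Cesaro means of the Fourier series of T converge to T in norm.
    They are averages of compressions of T to windows of consecutive coordinates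
    ([cesaro_contractive]), hence contractive, and they converge for polynomials
    ([fejer_approx]). So it suffices to generate the monomials U^n f where f
    vanishes off the wandering points and, if n = 0, at the accumulation points.
    The functions f with U^n f in a given closed ideal form a closed ideal of
    C_0(X), and this makes the question local ([C0_closed_ideal],
    [monomial_local]). Near a wandering point U^n g is compact for two reasons. If
    n > 0 and g lives on a wandering set, then (U^n g) S (U^n g) = 0 for every S
    ([compact_monomial_wandering]). If g lives at one isolated wandering point,
    then S |-> g S g has rank one ([compact_monomial_point]). *)

(** * Real-valued norms on complex normed modules *)

Section rnorm_theory.
Context {R : realType} {V : normedModType R[i]}.
Implicit Types (x y : V) (S : set V).

Lemma rnormN x : rnorm (- x) = rnorm x.
Proof. by rewrite /rnorm normrN. Qed.

Lemma rnorm_tri x y z : rnorm (x - z) <= rnorm (x - y) + rnorm (y - z).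
Proof. by rewrite (le_trans _ (rnormD _ _))// addrA subrK. Qed.

Lemma rnorm_leD x y : rnorm x <= rnorm y + rnorm (x - y).
Proof. by rewrite (le_trans _ (rnormD _ _))// addrC subrK. Qed.

Lemma rnorm_gt0 x : x != 0 -> 0 < rnorm x.
Proof.
move=> x0; rewrite lt_def rnorm_ge0 andbT.
by apply: contra_neq x0 => /rnorm_eq0.
Qed.

Lemma rnorm_sum (I : Type) (r : seq I) (P : pred I) (F : I -> V) :
  rnorm (\sum_(i <- r | P i) F i) <= \sum_(i <- r | P i) rnorm (F i).
Proof.
elim/big_rec2 : _ => [|i a x _ h]; first by rewrite rnorm0.
by rewrite (le_trans (rnormD _ _))// lerD2l.
Qed.

Lemma rnorm_le0 x : rnorm x <= 0 -> x = 0.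
Proof. by move=> x0; apply/rnorm_eq0/eqP; rewrite eq_le x0 rnorm_ge0. Qed.

Lemma rnorm_small x : (forall e : R, 0 < e -> rnorm x <= e) -> x = 0.
Proof.
move=> xe; apply: rnorm_le0; apply/ler_addgt0Pl => e e0.
by rewrite addr0; exact: xe.
Qed.

Lemma gt0_complexE (e : R[i]) : 0 < e -> exists2 r : R, 0 < r & e = r%:C.
Proof.
case: e => a b; rewrite ltcE /= => /andP[/eqP -> a0].
by exists a.
Qed.

Lemma nbhs_rnormP x (P : set V) :
  nbhs x P <-> exists2 e : R, 0 < e & forall y, rnorm (x - y) < e -> P y.
Proof.
split=> [/nbhs_normP[e /= e0 eP]|[e e0 eP]].
  have [r r0 er] := gt0_complexE e0; exists r => // y xy.
  by apply: eP; rewrite /ball_ /= rnormE er ltcR.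
apply/nbhs_normP; exists (e%:C); first by rewrite /= ltcR.
by move=> y; rewrite /ball_ /= rnormE ltcR; exact: eP.
Qed.

Lemma closure_rnormP S x :
  closure S x <-> forall e : R, 0 < e -> exists2 y, S y & rnorm (x - y) < e.
Proof.
split=> [Sx e e0|Sx B /nbhs_rnormP[e e0 eB]].
  have /Sx[y [Sy xy]] : nbhs x [set y | rnorm (x - y) < e].
    by apply/nbhs_rnormP; exists e.
  by exists y.
by have [y Sy xy] := Sx e e0; exists y; split => //; exact: eB.
Qed.

Lemma closed_rnormP S :
  (forall x, (forall e : R, 0 < e -> exists2 y, S y & rnorm (x - y) < e) -> S x) ->
  closed S.
Proof. by move=> h x /closure_rnormP; exact: h. Qed.

Lemma cvg_rnormP {T : Type} {F : set_system T} {FF : Filter F} (f : T -> V) x :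
  f @ F --> x <->
  forall e : R, 0 < e -> \forall t \near F, rnorm (x - f t) < e.
Proof.
split=> [fx e e0|fx].
  have : nbhs x [set y | rnorm (x - y) < e] by apply/nbhs_rnormP; exists e.
  exact: fx.
move=> P /nbhs_rnormP[e e0 eP]; have := fx _ e0.
by apply: filterS => t; exact: eP.
Qed.

Lemma cvgn_rnormP (u : nat -> V) x :
  u @ \oo --> x <->
  forall e : R, 0 < e ->
    exists N, forall n, (N <= n)%N -> rnorm (x - u n) < e.
Proof.
split=> [/cvg_rnormP ux e /ux[N _ Nu]|ux].
  by exists N => n Nn; exact: Nu.
by apply/cvg_rnormP => e /ux[N Nu]; exists N.
Qed.

Lemma bounded_rnormP S :
  bounded_set S <-> exists M : R, forall x, S x -> rnorm x <= M.
Proof.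
split=> [/pinfty_ex_gt0[M M0 /= SM]|[M SM]].
  have [r r0 er] := gt0_complexE M0; exists r => x Sx.
  by rewrite -lecR -rnormE -er; exact: SM.
exists M%:C; split=> [|y My x /SM xM].
  by rewrite realE /= !lecE /= eqxx /= le_total.
by rewrite /= rnormE (le_trans _ (ltW My))// lecR.
Qed.

(** Covering the compact closure by balls gives the net; its centres need not lie
    in [S]. *)
Lemma precompact_net S : precompact S -> forall e : R, 0 < e ->
  exists s : seq V, forall x, S x -> exists2 y, y \in s & rnorm (x - y) < e.
Proof.
rewrite precompactE compact_cover => Sc e e0.
have [||D _ SD] := Sc V (closure S) (fun y => [set x | rnorm (x - y) < e]).
- move=> y _; rewrite openE => x /= xy; apply/nbhs_rnormP.
  exists (e - rnorm (x - y)); first by rewrite subr_gt0.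
  move=> z; rewrite ltrBrDr rnormB; apply: le_lt_trans.
  exact: rnorm_tri.
- by move=> x Sx; exists x; rewrite //= subrr rnorm0.
exists (enum_fset D) => x /subset_closure /SD[y yD /= xy].
by exists y.
Qed.

End rnorm_theory.

Lemma lipschitz_continuous (R : realType) (V W : normedModType R[i]) (f : V -> W)
    (M : R) : (forall x y, rnorm (f x - f y) <= M * rnorm (x - y)) -> continuous f.
Proof.
move=> fM x; apply/cvg_rnormP => e e0; apply/nbhs_rnormP.
have M0 : 0 < `|M| + 1 by rewrite ltr_wpDl.
exists (e / (`|M| + 1)); first by rewrite divr_gt0.
move=> y; rewrite ltr_pdivlMr// mulrC; apply: le_lt_trans.
rewrite (le_trans (fM _ _))// ler_wpM2r ?rnorm_ge0//.
by rewrite (le_trans (ler_norm M))// lerDl.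
Qed.

Section complex_rnorm.
Context {R : realType}.
Implicit Types (a b : R[i]) (r : R).

Lemma rnorm_real r : rnorm (r%:C : R[i]^o) = `|r|.
Proof.
apply: complexI; rewrite -rnormE normc_def /= expr0n addr0.
by rewrite sqrtr_sqr.
Qed.

Lemma rnorm_ge_Re a : `|complex.Re a| <= rnorm (a : R[i]^o).
Proof.
rewrite -lecR -rnormE normc_def lecR -sqrtr_sqr ler_wsqrtr// lerDl.
exact: sqr_ge0.
Qed.

Lemma rnorm_ge_Im a : `|complex.Im a| <= rnorm (a : R[i]^o).
Proof.
rewrite -lecR -rnormE normc_def lecR -sqrtr_sqr ler_wsqrtr// lerDr.
exact: sqr_ge0.
Qed.

Lemma rnorm_le_ReIm a :
  rnorm (a : R[i]^o) <= `|complex.Re a| + `|complex.Im a|.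
Proof.
rewrite -lecR -rnormE normc_def lecR.
rewrite -[leRHS]ger0_norm ?addr_ge0// -sqrtr_sqr ler_wsqrtr//.
rewrite sqrrD !real_normK ?num_real// -addrA lerD2l lerDr.
by rewrite mulrn_wge0// mulr_ge0.
Qed.

Lemma mul_conjc_rnorm a : a * Num.conj a = (rnorm (a : R[i]^o) ^+ 2)%:C.
Proof. by rewrite -normCK rnormE rmorphXn. Qed.

Lemma conj_real r : Num.conj (r%:C : R[i]) = r%:C.
Proof. by apply/CrealP; rewrite realE !lecE /= eqxx /= le_total. Qed.

Lemma cvg_real {T : Type} {F : set_system T} {FF : Filter F} (f : T -> R) r :
  f @ F --> r -> (fun t => (f t)%:C : R[i]^o) @ F --> (r%:C : R[i]^o).
Proof.
move=> /cvgrPdist_lt fr; apply/cvg_rnormP => e /fr; apply: filterS => t.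
by rewrite -rmorphB /= rnorm_real.
Qed.

End complex_rnorm.

(** The disc of scalars lies in a compact square, and a line is the image of the
    scalars under a continuous map. *)
Lemma precompact_line (R : realType) (V : normedModType R[i]) (v : V) (M : R)
    (S : set V) :
  (forall x, S x -> exists2 c : R[i], x = c *: v & rnorm (c : R[i]^o) <= M) ->
  precompact S.
Proof.
move=> SM; pose Q := `[(- M)%R, M]%classic : set R.
pose g (p : R * R) : V := (p.1%:C + 'i * p.2%:C) *: v.
have gc : continuous g.
  move=> p.
  have h (q : R * R -> R) : {for p, continuous q} ->
      (fun x => (q x)%:C : R[i]^o) @ p --> ((q p)%:C : R[i]^o).
    exact: cvg_real.
  apply: (@cvgZr_tmp _ V _ _ _ (fun p : R * R => (p.1%:C + 'i * p.2%:C : R[i]^o))).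
  apply: (@cvgD _ R[i]^o); first by apply: h; exact: cvg_fst.
  apply: (@cvgZ _ R[i]^o _ _ _ (cst 'i) (fun x : R * R => x.2%:C : R[i]^o)).
    exact: cvg_cst.
  by apply: h; exact: cvg_snd.
have K : compact (g @` (Q `*` Q)).
  apply: continuous_compact; first exact: continuous_subspaceT.
  by apply: compact_setX; exact: segment_compact.
apply: (@precompact_subset _ _ (g @` (Q `*` Q))); last first.
  exact: (compact_precompact (@norm_hausdorff _ V)).
move=> x /SM[c -> cM]; exists (complex.Re c, complex.Im c).
  rewrite /Q; split; rewrite /= in_itv /= -ler_norml.
    exact: le_trans (rnorm_ge_Re c) cM.
  exact: le_trans (rnorm_ge_Im c) cM.
by rewrite /g /= -complexE.
Qed.

(** * Pointwise operations on bounded operators *)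

Section BL_theory.
Context {R : realType} {V : normedModType R[i]}.
Implicit Types (S T : BL V) (x y : V).

Lemma BL_ext S T : (forall x, S x = T x) -> S = T.
Proof. by move=> ST; apply/val_inj/funext. Qed.

Lemma BL_addE S T x : (S + T) x = S x + T x. Proof. by []. Qed.

Lemma BL_oppE S x : (- S) x = - S x. Proof. by []. Qed.

Lemma BL_scaleE (a : R[i]) S x : (a *: S) x = a *: S x. Proof. by []. Qed.

Lemma BL_sumE (I : Type) (r : seq I) (P : pred I) (F : I -> BL V) x :
  (\sum_(i <- r | P i) F i) x = \sum_(i <- r | P i) F i x.
Proof. by elim/big_rec2 : _ => // i _ y _ <-. Qed.

Lemma BL_compE S T x : BL_comp S T x = S (T x). Proof. by []. Qed.

Lemma BLD T x y : T (x + y) = T x + T y.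
Proof. by have := (BLP T).1 1 x y; rewrite !scale1r. Qed.

Lemma BL0 T : T 0 = 0.
Proof. by apply: (@addrI _ (T 0)); rewrite -BLD !addr0. Qed.

Lemma BL_linearZ T (a : R[i]) x : T (a *: x) = a *: T x.
Proof. by have := (BLP T).1 a x 0; rewrite BL0 !addr0. Qed.

Lemma BLN T x : T (- x) = - T x.
Proof. by rewrite -scaleN1r BL_linearZ scaleN1r. Qed.

Lemma BLB T x y : T (x - y) = T x - T y.
Proof. by rewrite BLD BLN. Qed.

Lemma BL_sum T (I : Type) (r : seq I) (P : pred I) (F : I -> V) :
  T (\sum_(i <- r | P i) F i) = \sum_(i <- r | P i) T (F i).
Proof.
elim/big_rec2 : _ => [|i x y _ <-]; first by rewrite BL0.
by rewrite BLD.
Qed.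

Lemma BL_rnorm_ub T x : rnorm (T x) <= rnorm T * rnorm x.
Proof. exact: op_norm_ub. Qed.

Lemma BL_rnorm_le T (M : R) : 0 <= M ->
  (forall x, rnorm (T x) <= M * rnorm x) -> rnorm T <= M.
Proof.
move=> M0 TM; apply: op_norm_le => x x1.
by rewrite (le_trans (TM x))// ler_piMr.
Qed.

Lemma BL_comp_rnorm S T : rnorm (BL_comp S T) <= rnorm S * rnorm T.
Proof.
apply: BL_rnorm_le => [|x]; first by rewrite mulr_ge0 ?rnorm_ge0.
rewrite -mulrA BL_compE (le_trans (BL_rnorm_ub _ _))//.
by rewrite ler_wpM2l ?rnorm_ge0// BL_rnorm_ub.
Qed.

Lemma BL_compDl S1 S2 T : BL_comp (S1 + S2) T = BL_comp S1 T + BL_comp S2 T.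
Proof. exact: BL_ext. Qed.

Lemma BL_compDr S T1 T2 : BL_comp S (T1 + T2) = BL_comp S T1 + BL_comp S T2.
Proof. by apply: BL_ext => x; rewrite BL_compE BLD. Qed.

Lemma BL_compNl S T : BL_comp (- S) T = - BL_comp S T.
Proof. exact: BL_ext. Qed.

Lemma BL_compNr S T : BL_comp S (- T) = - BL_comp S T.
Proof. by apply: BL_ext => x; rewrite BL_compE BLN. Qed.

Lemma BL_compBl S1 S2 T : BL_comp (S1 - S2) T = BL_comp S1 T - BL_comp S2 T.
Proof. by rewrite BL_compDl BL_compNl. Qed.

Lemma BL_compBr S T1 T2 : BL_comp S (T1 - T2) = BL_comp S T1 - BL_comp S T2.
Proof. by rewrite BL_compDr BL_compNr. Qed.

Lemma BL_construct (f : V -> V) (M : R) : linear f ->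
  (forall x, rnorm (f x) <= M * rnorm x) -> f \in @BL_pred R V.
Proof.
move=> fl fM; apply/asboolP; split=> //.
apply: (@lipschitz_continuous _ _ _ f M) => x y.
by have := fl (-1) y x; rewrite !scaleN1r addrC => <-; rewrite addrC fM.
Qed.

End BL_theory.
(** * The algebra of continuous functions vanishing at infinity *)

Section C0_theory.
Context {R : realType} {X : topologicalType}.
Implicit Types f g h : C0 R X.

Lemma C0_ext f g : (forall x, f x = g x) -> f = g.
Proof. by move=> fg; apply/val_inj/funext. Qed.

Lemma C0_rnorm_ub f x : rnorm (f x) <= rnorm f.
Proof. exact: sup_norm_ub. Qed.

Lemma C0_rnorm_le f (M : R) :
  0 <= M -> (forall x, rnorm (f x) <= M) -> rnorm f <= M.
Proof. exact: sup_norm_le. Qed.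

Lemma C0_sumE (I : Type) (r : seq I) (P : pred I) (F : I -> C0 R X) x :
  (\sum_(i <- r | P i) F i) x = \sum_(i <- r | P i) F i x.
Proof. by elim/big_rec2 : _ => // i _ y _ <-. Qed.

Lemma rnorm_C0_continuous f : continuous (fun x => rnorm (f x)).
Proof.
move=> x; apply: continuous_comp; last exact: rnorm_continuous.
exact: (C0P f).1.
Qed.

(** Superlevel sets of [u] are closed in compact superlevel sets of [f]: every
    function built from [f] by functional calculus is obtained this way. *)
Lemma C0_dominated f (u : X -> R[i]^o) (M : R) :
  continuous u -> (forall x, rnorm (u x) <= M * rnorm (f x)) ->
  u \in @C0_pred R X.
Proof.
move=> uc uf; have [fc f0] := C0P f; apply/asboolP; split=> // e e0.
have M0 : 0 < `|M| + 1 by rewrite ltr_wpDl.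
apply: (subclosed_compact (rnorm_level_closed uc)).
  exact: (f0 (e / (`|M| + 1)) (divr_gt0 e0 M0)).
move=> x /= ex; rewrite ler_pdivrMr// mulrC (le_trans ex)// (le_trans (uf x))//.
by rewrite ler_wpM2r ?rnorm_ge0// (le_trans (ler_norm M))// lerDl.
Qed.

Lemma C0_dominated_real f (u : X -> R) (M : R) :
  continuous u -> (forall x, `|u x| <= M * rnorm (f x)) ->
  (fun x => (u x)%:C : R[i]^o) \in @C0_pred R X.
Proof.
move=> uc uf; apply: (@C0_dominated f _ M) => [x|x].
  by apply: cvg_real; exact: uc.
by rewrite rnorm_real.
Qed.

Lemma C0_cut_subproof f (u : X -> R) (M : R) :
  continuous u -> (forall x, `|u x| <= M) ->
  (fun x => (u x)%:C * f x : R[i]^o) \in @C0_pred R X.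
Proof.
move=> uc uM; apply: (@C0_dominated f _ M) => x.
  apply: (@cvgZ _ R[i]^o _ _ _ (fun x => (u x)%:C : R[i]^o)).
    by apply: cvg_real; exact: uc.
  exact: (C0P f).1.
by rewrite rnormM rnorm_real ler_wpM2r ?rnorm_ge0.
Qed.

(** Real limits are squeezed between the suprema and the infima of the intervals
    of radius [d j] about the terms, so no convergence argument is required. *)
Lemma real_limit (u d : nat -> R) :
  (forall j k, `|u j - u k| <= d j + d k) -> exists l, forall j, `|u j - l| <= d j.
Proof.
move=> ud; pose S := [set u j - d j | j in [set: nat]].
have SE j k : u j - d j <= u k + d k.
  by have := ler_normlW (ud j k); lra.
have S0 : S !=set0 by exists (u 0%N - d 0%N), 0%N.
exists (sup S) => j; rewrite ler_norml; apply/andP; split.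
  suff : sup S <= u j + d j by lra.
  by apply: ge_sup => // _ [k _ <-]; exact: SE.
suff : u j - d j <= sup S by lra.
apply: ub_le_sup; last by exists j.
by exists (u 0%N + d 0%N) => _ [k _ <-]; exact: SE.
Qed.

Lemma complex_limit (u : nat -> R[i]^o) (d : nat -> R) :
  (forall j k, rnorm (u j - u k) <= d j + d k) ->
  exists l, forall j, rnorm (u j - l) <= 2 * d j.
Proof.
move=> ud.
have [a ua] : exists l, forall j, `|complex.Re (u j) - l| <= d j.
  apply: real_limit => j k; apply: le_trans (ud j k).
  apply: le_trans (rnorm_ge_Re _); rewrite [leLHS](_ : _ = `|complex.Re (u j - u k)|)//.
  by case: (u j) (u k) => [? ?] [? ?].
have [b ub] : exists l, forall j, `|complex.Im (u j) - l| <= d j.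
  apply: real_limit => j k; apply: le_trans (ud j k).
  apply: le_trans (rnorm_ge_Im _); rewrite [leLHS](_ : _ = `|complex.Im (u j - u k)|)//.
  by case: (u j) (u k) => [? ?] [? ?].
exists (a +i* b) => j; apply: le_trans (rnorm_le_ReIm _) _.
move: (ua j) (ub j); case: (u j) => [p q] /= hp hq.
by rewrite mulr_natl mulr2n lerD.
Qed.

(** Uniform limits of functions vanishing at infinity. The explicit rate carries
    the estimates on the approximants over to the limit. *)
Lemma C0_complete (F : nat -> C0 R X) (d : nat -> R) :
  (forall j k, rnorm (F j - F k) <= d j + d k) ->
  (forall e, 0 < e -> exists j, d j < e) ->
  exists f, forall j, rnorm (F j - f) <= 2 * d j.
Proof.
move=> Fd d0.
have dge j : 0 <= d j by have := le_trans (rnorm_ge0 _) (Fd j j); lra.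
have /choice[u uF] : forall x, exists l, forall j, rnorm (F j x - l) <= 2 * d j.
  move=> x; apply: complex_limit => j k; apply: le_trans (Fd j k).
  exact: (C0_rnorm_ub (F j - F k)).
have uc : continuous u.
  move=> x; apply/cvg_rnormP => e e0.
  have [j dj] := d0 (e / 6) (divr_gt0 e0 (ltr0n _ 6)).
  have e3 : 0 < e / 3 by rewrite divr_gt0.
  have := (C0P (F j)).1 x; move=> /cvg_rnormP/(_ _ e3).
  apply: filterS => y xy.
  have h1 := uF x j; have h2 := uF y j.
  have := rnorm_tri (u x) (F j x) (u y); have := rnorm_tri (F j x) (F j y) (u y).
  rewrite (rnormB (u x) (F j x)); lra.
have u0 : u \in @C0_pred R X.
  apply/asboolP; split=> // e e0.
  have [j dj] := d0 (e / 4) (divr_gt0 e0 (ltr0n _ 4)).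
  apply: (subclosed_compact (rnorm_level_closed uc)).
    exact: ((C0P (F j)).2 (e / 2) (divr_gt0 e0 (ltr0n _ 2))).
  move=> x /= ex; have := uF x j.
  by have := rnorm_leD (u x) (F j x); rewrite (rnormB (u x) (F j x)); lra.
exists (MkC0 u0) => j; apply: C0_rnorm_le => [|x]; first by rewrite mulr_ge0.
exact: uF.
Qed.

(** Sums of squared moduli of elements of [J] give a nonnegative
    [h] in [J] with [h > 1] on the compact set where [f] is not small; then
    [h * (f / max 1 h)] lies in [J], agrees with [f] there, and is as small as
    [f] elsewhere. *)
Lemma C0_closed_ideal (J : set (C0 R X)) f :
  J 0 -> (forall g h, J g -> J h -> J (g + h)) ->
  (forall g h, J g -> J (C0_mul g h)) ->
  (forall g, (forall e : R, 0 < e -> exists2 h, J h & rnorm (g - h) <= e) -> J g) ->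
  (forall x, f x != 0 -> exists2 g, J g & g x != 0) -> J f.
Proof.
move=> J0 JD JM Jcl fJ; apply: Jcl => e e0.
pose P h := J h /\ exists2 r : X -> R, forall x, 0 <= r x & forall x, h x = (r x)%:C.
pose F : set_system (C0 R X) := [set U | exists2 h0, P h0 &
  forall h, P h -> (forall x, complex.Re (h0 x) <= complex.Re (h x)) -> U h].
have PD g h : P g -> P h -> P (g + h).
  move=> [Jg [r r0 gr]] [Jh [s s0 hs]]; split; first exact: JD.
  exists (r \+ s) => x /=; first by rewrite addr_ge0.
  by rewrite -[LHS]/(g x + h x) gr hs rmorphD.
have Pge g x : P g -> 0 <= complex.Re (g x) by move=> [_ [r r0 ->]] /=.
have FF : Filter F.
  split=> [|A B [g Pg gA] [h Ph hB]|A B AB [g Pg gA]].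
  - by exists 0 => //; split=> //; exists (fun=> 0).
  - exists (g + h); first exact: PD.
    move=> k Pk ghk; split; [apply: gA => // x|apply: hB => // x].
      apply: le_trans (ghk x); rewrite -[(g + h) x]/(g x + h x).
      by rewrite raddfD lerDl Pge.
    apply: le_trans (ghk x); rewrite -[(g + h) x]/(g x + h x).
    by rewrite raddfD lerDr Pge.
  - by exists g => // h Ph gh; apply: AB; exact: gA.
have [h [Jh [r r0 hr]] hK] : F [set h | [set x | e <= rnorm (f x)] `<=`
    [set x | 1 < complex.Re (h x)]].
  have /compact_near_coveringP K := (C0P f).2 e e0.
  apply: (K _ F (fun h x => 1 < complex.Re (h x)) FF) => x /= ex.
  have [|g Jg gx] := fJ x.
    by apply: contraTneq ex => ->; rewrite rnorm0 -ltNge.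
  have gx0 := rnorm_gt0 gx.
  (* The factor 4 makes [h0 > 1] wherever [|g|] exceeds half of [|g x|]. *)
  pose c : R := 4 / rnorm (g x) ^+ 2.
  have c0 : 0 < c by rewrite divr_gt0// exprn_gt0.
  pose h0 := C0_mul g (c%:C *: C0_conj g).
  have h0E y : h0 y = (c * rnorm (g y) ^+ 2)%:C.
    rewrite -[LHS]/(g y * (c%:C * Num.conj (g y : R[i]))).
    by rewrite mulrCA mul_conjc_rnorm -rmorphM.
  have Ph0 : P h0.
    split; first exact: JM.
    by exists (fun y => c * rnorm (g y) ^+ 2) => // y; rewrite mulr_ge0 ?sqr_ge0 ?ltW.
  exists ([set y | rnorm (g x) / 2 < rnorm (g y)],
      [set h | P h /\ forall x, complex.Re (h0 x) <= complex.Re (h x)]).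
    split=> /=; last by exists h0.
    have := @rnorm_C0_continuous g x; move/cvgrPdist_lt => /(_ (rnorm (g x) / 2)).
    rewrite divr_gt0// => /(_ isT); apply: filterS => y /ltr_normlW /=; lra.
  move=> [y h] /= [gy [Ph h0h]]; apply: lt_le_trans (h0h y).
  rewrite [X in _ < complex.Re X]h0E /= /c mulrAC ltr_pdivlMr ?exprn_gt0// mul1r.
  have : (rnorm (g x) / 2) ^+ 2 < rnorm (g y) ^+ 2.
    by rewrite ltr_sqr// nnegrE ?rnorm_ge0// ltW// divr_gt0.
  by rewrite exprMn; lra.
have {}hK x : e <= rnorm (f x) -> 1 < r x.
  by move=> /(hK h (conj Jh (ex_intro2 _ _ r r0 hr)) (fun=> lexx _)) /=; rewrite hr.
pose m x := Num.max 1 (r x).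
have m1 x : 1 <= m x by rewrite le_max lexx.
have m0 x : 0 < m x by exact: lt_le_trans ltr01 (m1 x).
have rc : continuous r.
  have -> : r = fun x => rnorm (h x).
    by apply/funext => x; rewrite hr rnorm_real ger0_norm.
  exact: rnorm_C0_continuous.
have mc : continuous (fun x => (m x)^-1).
  move=> x; apply: cvgV; first by rewrite gt_eqF.
  by apply: continuous_max; [exact: cvg_cst|exact: rc].
have m2 x : `|(m x)^-1| <= 1.
  by rewrite ger0_norm ?invf_le1// invr_ge0 ltW.
exists (C0_mul h (MkC0 (C0_cut_subproof f mc m2))); first exact: JM.
apply: C0_rnorm_le => [|x]; first exact: ltW.
rewrite -[X in rnorm X]/(f x - h x * ((m x)^-1%:C * f x)) hr mulrA -rmorphM /=.
have [ex|/ltW ex] := leP e (rnorm (f x)).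
  have rx := hK _ ex.
  have rx0 : 0 < r x by exact: lt_trans rx.
  by rewrite /m (max_idPr (ltW rx)) divff ?gt_eqF// mul1r subrr rnorm0 ltW.
rewrite -[X in X - _](mul1r (f x)) -mulrBl.
rewrite (_ : 1 - (r x / m x)%:C = (1 - r x / m x)%:C); last by rewrite rmorphB.
rewrite rnormM rnorm_real (le_trans _ ex)// ler_piMl ?rnorm_ge0//.
have q0 : 0 <= r x / m x by rewrite divr_ge0// ltW.
have q1 : r x / m x <= 1 by rewrite ler_pdivrMr// mul1r /m le_max lexx orbT.
by rewrite ger0_norm; lra.
Qed.

End C0_theory.

(** * Faithful representations of C_0(X) are isometric *)

Section representation.
Context {R : realType} {X : topologicalType} {H : normedModType R[i]}.
Context {dotp : {dot H for Num.conj}}.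
Context (dotp_norm : forall x : H, `|x| ^+ 2 = dotp x x).
Context {sigma : C0 R X -> BL H}.
Context (sigma_rep : faithful_representation dotp sigma).
Implicit Types (f g : C0 R X) (xi : H).

Lemma dotp_rnorm xi : dotp xi xi = (rnorm xi ^+ 2)%:C.
Proof. by rewrite -dotp_norm rnormE rmorphXn. Qed.

Lemma rep_additive f g : sigma (f + g) = sigma f + sigma g.
Proof. by have := rep_linear sigma_rep 1 f g; rewrite !scale1r. Qed.

Lemma rep0 : sigma 0 = 0.
Proof. by apply: (@addrI _ (sigma 0)); rewrite -rep_additive !addr0. Qed.

Lemma rep_scale a f : sigma (a *: f) = a *: sigma f.
Proof. by have := rep_linear sigma_rep a f 0; rewrite rep0 !addr0. Qed.

Lemma rep_oppr f : sigma (- f) = - sigma f.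
Proof. by rewrite -scaleN1r rep_scale scaleN1r. Qed.

Lemma rep_mulE f g xi : sigma (C0_mul f g) xi = sigma f (sigma g xi).
Proof. by rewrite (rep_mul sigma_rep). Qed.

Lemma dotp_rep_square f xi :
  dotp (sigma (C0_mul (C0_conj f) f) xi) xi = (rnorm (sigma f xi) ^+ 2)%:C.
Proof.
rewrite rep_mulE (rep_star sigma_rep) -dotp_rnorm; congr (dotp _ (sigma _ _)).
by apply: C0_ext => x; exact: conjCK.
Qed.

Lemma conj_mulE f x : C0_mul (C0_conj f) f x = (rnorm (f x) ^+ 2)%:C.
Proof. by rewrite -mul_conjc_rnorm mulrC. Qed.

(** Positivity: |g|^2 - |f|^2 is a square q^2 in C_0(X), so |sigma g xi|^2
    exceeds |sigma f xi|^2 by |sigma q xi|^2. *)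
Lemma rep_mono f g xi : (forall x, rnorm (f x) <= rnorm (g x)) ->
  rnorm (sigma f xi) <= rnorm (sigma g xi).
Proof.
move=> fg.
pose q x := Num.sqrt (rnorm (g x) ^+ 2 - rnorm (f x) ^+ 2).
have q0 x : 0 <= rnorm (g x) ^+ 2 - rnorm (f x) ^+ 2.
  by rewrite subr_ge0 ler_sqr// nnegrE rnorm_ge0.
have qc : continuous q.
  move=> x; apply: (@continuous_comp _ _ _
    (fun x => rnorm (g x) ^+ 2 - rnorm (f x) ^+ 2) Num.sqrt).
    by apply: cvgB; apply: cvgM; exact: rnorm_C0_continuous.
  exact: sqrt_continuous.
have qg x : `|q x| <= 1 * rnorm (g x).
  rewrite mul1r ger0_norm ?sqrtr_ge0// -[leRHS]ger0_norm ?rnorm_ge0//.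
  by rewrite -sqrtr_sqr ler_wsqrtr// lerBlDr lerDl sqr_ge0.
pose Q := MkC0 (C0_dominated_real qc qg).
have E : C0_mul (C0_conj g) g = C0_mul (C0_conj f) f + C0_mul (C0_conj Q) Q.
  apply: C0_ext => x; rewrite -[RHS]/(C0_mul (C0_conj f) f x + C0_mul (C0_conj Q) Q x).
  rewrite !conj_mulE -rmorphD /= rnorm_real real_normK ?num_real//.
  by rewrite sqr_sqrtr// addrC subrK.
rewrite -ler_sqr ?nnegrE ?rnorm_ge0// -lecR -!dotp_rep_square E rep_additive BL_addE.
rewrite linearDl /= !dotp_rep_square -[leRHS]rmorphD /= lecR lerDl.
exact: sqr_ge0.
Qed.

(** With u = 1 - sqrt (1 - |f|^2), an element of C_0(X) although 1 need not be
    one, |f|^2 = 2 u - u^2, so that |xi|^2 - |sigma f xi|^2 is the square of the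
    norm of xi - sigma u xi. *)
Lemma rep_contractive1 f xi : rnorm f <= 1 -> rnorm (sigma f xi) <= rnorm xi.
Proof.
move=> f1.
have fx1 x : rnorm (f x) ^+ 2 <= 1.
  by rewrite -(expr1n _ 2) ler_sqr ?nnegrE ?rnorm_ge0// (le_trans (C0_rnorm_ub f x)).
pose u x := 1 - Num.sqrt (1 - rnorm (f x) ^+ 2).
have s0 x : 0 <= 1 - rnorm (f x) ^+ 2 by rewrite subr_ge0.
have uc : continuous u.
  move=> x; apply: cvgB; first exact: cvg_cst.
  apply: (@continuous_comp _ _ _ (fun x => 1 - rnorm (f x) ^+ 2) Num.sqrt).
    by apply: cvgB; [exact: cvg_cst|apply: cvgM; exact: rnorm_C0_continuous].
  exact: sqrt_continuous.
have uf x : `|u x| <= 1 * rnorm (f x).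
  rewrite mul1r /u.
  have t0 := sqrtr_ge0 (1 - rnorm (f x) ^+ 2).
  have t2 := sqr_sqrtr (s0 x); have := rnorm_ge0 (f x).
  move: t0 t2; set t := Num.sqrt _; set p := rnorm _ => t0 t2 p0.
  by rewrite ler_norml; apply/andP; split; nra.
pose U := MkC0 (C0_dominated_real uc uf).
have E : C0_mul (C0_conj f) f = U + U - C0_mul (C0_conj U) U.
  apply: C0_ext => x.
  rewrite -[RHS]/(U x + U x - C0_mul (C0_conj U) U x).
  rewrite !conj_mulE -!rmorphD -rmorphB /= rnorm_real real_normK ?num_real//.
  congr _%:C; have t2 := sqr_sqrtr (s0 x).
  by move: t2; rewrite /u; set t := Num.sqrt _ => t2; ring: t2.
have UJ : C0_conj U = U by apply: C0_ext => x; exact: conj_real.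
have UU : dotp (sigma U xi) xi = dotp xi (sigma U xi).
  by rewrite (rep_star sigma_rep) UJ.
have sq : dotp xi xi - dotp (sigma (C0_mul (C0_conj f) f) xi) xi =
    dotp (xi - sigma U xi) (xi - sigma U xi).
  rewrite E !rep_additive rep_oppr !BL_addE BL_oppE.
  rewrite linearBl linearDl [RHS]linearBl !linearBr /=.
  by rewrite UU dotp_rep_square -dotp_rnorm; ring.
rewrite -ler_sqr ?nnegrE ?rnorm_ge0// -subr_ge0 -(ler0c) rmorphB /=.
by rewrite -dotp_rep_square -dotp_rnorm sq dotp_rnorm ler0c sqr_ge0.
Qed.

Lemma rep_contractive f xi : rnorm (sigma f xi) <= rnorm f * rnorm xi.
Proof.
have [->|f0] := eqVneq f 0.
  by rewrite rep0 [X in rnorm X](_ : _ = 0)// rnorm0 mulr_ge0 ?rnorm_ge0.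
have f1 := rnorm_gt0 f0.
have r1 : rnorm ((rnorm f)^-1%:C *: f) <= 1.
  by rewrite rnormZ rnorm_real ger0_norm ?invr_ge0 ?rnorm_ge0// mulVf// gt_eqF.
have := rep_contractive1 xi r1; rewrite rep_scale.
rewrite BL_scaleE rnormZ rnorm_real.
by rewrite ger0_norm ?invr_ge0 ?rnorm_ge0// mulrC ler_pdivrMr// mulrC.
Qed.

(** The function k = max (|f| - c, 0) is nonzero and lives where |f| >= c, so
    that |c k| <= |f k|: by faithfulness some vector sigma k xi is nonzero, and
    sigma f expands it by at least c. *)
Lemma rep_almost_attained f (c : R) : 0 <= c -> c < rnorm f ->
  exists2 eta, eta != 0 & c * rnorm eta <= rnorm (sigma f eta).
Proof.
move=> c0 cf.
pose k x := Num.max (rnorm (f x) - c) 0.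
have kc : continuous k.
  move=> x; apply: (@continuous_max _ _ (fun x => rnorm (f x) - c) (cst 0)).
    by apply: cvgB; [exact: rnorm_C0_continuous|exact: cvg_cst].
  exact: cvg_cst.
have k0 x : 0 <= k x by rewrite le_max lexx orbT.
have kf x : `|k x| <= 1 * rnorm (f x).
  by rewrite mul1r ger0_norm// ge_max rnorm_ge0 lerBlDr lerDl c0.
pose K := MkC0 (C0_dominated_real kc kf).
have K0 : sigma K != 0.
  apply: contraTneq cf => /eqP; rewrite -rep0 -leNgt => /eqP /(rep_faithful sigma_rep) K0.
  apply: C0_rnorm_le => // x.
  have : K x = 0 by rewrite K0.
  by move=> [kx]; rewrite -subr_le0 -kx le_max lexx.
have [xi xi0] : exists xi, sigma K xi != 0.
  apply: contrapT => /forallNP h; move/eqP: K0; apply; apply/val_inj/funext => xi.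
  by have /negP := h xi; rewrite negbK => /eqP.
exists (sigma K xi) => //.
rewrite -rep_mulE -[leLHS](_ : rnorm (sigma (c%:C *: K) xi) = _); last first.
  rewrite rep_scale BL_scaleE rnormZ rnorm_real.
  by rewrite ger0_norm.
apply: rep_mono => x.
rewrite -[X in rnorm X]/(c%:C * (k x)%:C) -[X in _ <= rnorm X]/(f x * (k x)%:C).
rewrite !rnormM !rnorm_real !ger0_norm//.
have [kx|kx] := leP (rnorm (f x) - c) 0.
  by rewrite /k (max_idPr kx) !mulr0.
by rewrite ler_wpM2r// -subr_ge0 ltW.
Qed.

Lemma rep_isometric f (M : R) : 0 <= M ->
  (forall xi, rnorm (sigma f xi) <= M * rnorm xi) -> rnorm f <= M.
Proof.
move=> M0 fM; rewrite leNgt; apply/negP => Mf.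
have [||eta eta0 h] := @rep_almost_attained f ((M + rnorm f) / 2); [lra|lra|].
have := le_trans h (fM eta); rewrite ler_pM2r ?rnorm_gt0//; lra.
Qed.

Lemma rep_eq f g : (forall xi, sigma f xi = sigma g xi) -> f = g.
Proof. by move=> fg; apply: (rep_faithful sigma_rep); apply/val_inj/funext. Qed.

End representation.

(** * Square-summable sequences *)

Section l2_theory.
Context {R : realType} {H : normedModType R[i]}.
Implicit Types (u v : l2 H) (xi : H).

Lemma l2_ext u v : (forall i, u i = v i) -> u = v.
Proof. by move=> uv; apply/val_inj/funext. Qed.

Lemma l2_addE u v i : (u + v) i = u i + v i. Proof. by []. Qed.

Lemma l2_subE u v i : (u - v) i = u i - v i. Proof. by []. Qed.

Lemma l2_scaleE a u i : (a *: u) i = a *: u i. Proof. by []. Qed.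

Lemma l2_sumE (I : Type) (r : seq I) (P : pred I) (F : I -> l2 H) k :
  (\sum_(i <- r | P i) F i) k = \sum_(i <- r | P i) F i k.
Proof. by elim/big_rec2 : _ => // i _ y _ <-. Qed.

Lemma tensorE xi k i : tensor xi k i = if i == k then xi else 0.
Proof. by []. Qed.

Let S (u : nat -> H) n : R := \sum_(i < n) rnorm (u i) ^+ 2.

Let seriesE (u : nat -> H) n : series (fun n => rnorm (u n) ^+ 2) n = S u n.
Proof. by rewrite seriesEnat /= big_mkord. Qed.

Let S_nd (u : nat -> H) : nondecreasing_seq (series (fun n => rnorm (u n) ^+ 2)).
Proof.
apply/nondecreasing_seqP => n; rewrite !seriesE /S big_ord_recr /= lerDl.
exact: sqr_ge0.
Qed.

Let l2_sqrE v : rnorm v ^+ 2 = limn (series (fun n => rnorm (v n) ^+ 2)).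
Proof.
rewrite -[rnorm v]/(l2_rnorm v) sqr_sqrtr//.
apply: limr_ge; first exact: l2P.
apply: nearW => n; rewrite seriesE; apply: sumr_ge0 => i _; exact: sqr_ge0.
Qed.

Lemma l2_psum_ub v n : \sum_(i < n) rnorm (v i) ^+ 2 <= rnorm v ^+ 2.
Proof.
by rewrite l2_sqrE -[leLHS]/(S v n) -seriesE; apply: nondecreasing_cvgn_le; [exact: S_nd|exact: l2P].
Qed.

Lemma l2_rnorm_sqr_le v (M : R) :
  (forall n, \sum_(i < n) rnorm (v i) ^+ 2 <= M) -> rnorm v ^+ 2 <= M.
Proof.
move=> vM; rewrite l2_sqrE; apply: limr_le; first exact: l2P.
by apply: nearW => n; rewrite seriesE; exact: vM.
Qed.

Lemma l2_rnorm_le v (M : R) : 0 <= M ->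
  (forall n, \sum_(i < n) rnorm (v i) ^+ 2 <= M ^+ 2) -> rnorm v <= M.
Proof. by move=> M0 /l2_rnorm_sqr_le; rewrite ler_sqr ?nnegrE ?rnorm_ge0. Qed.

Lemma l2_construct (u : nat -> H) (M : R) :
  (forall n, \sum_(i < n) rnorm (u i) ^+ 2 <= M) -> u \in @l2_pred R H.
Proof.
move=> uM; apply/asboolP; apply: nondecreasing_is_cvgn; first exact: S_nd.
by exists M => _ [n _ <-]; rewrite seriesE; exact: uM.
Qed.

Lemma l2_coord_ub v i : rnorm (v i) <= rnorm v.
Proof.
rewrite -ler_sqr ?nnegrE ?rnorm_ge0// (le_trans _ (l2_psum_ub v i.+1))//.
by rewrite big_ord_recr /= lerDr sumr_ge0// => j _; exact: sqr_ge0.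
Qed.

Definition truncation v n : l2 H := \sum_(k < n) tensor (v k) k.

Lemma truncationE v n i : truncation v n i = if (i < n)%N then v i else 0.
Proof.
rewrite l2_sumE; case: ltnP => [ilt|ni].
  rewrite (bigD1 (Ordinal ilt))// tensorE eqxx big1 /= ?addr0// => k.
  by rewrite -val_eqE /= eq_sym => /negbTE ->.
rewrite big1// => k _; rewrite tensorE; case: eqVneq => // ik.
by have := ltn_ord k; rewrite -ik ltnNge ni.
Qed.

Lemma truncation_cvg v (e : R) : 0 < e -> exists N, forall n, (N <= n)%N ->
  rnorm (v - truncation v n) < e.
Proof.
move=> e0; have e2 : 0 < e ^+ 2 / 4 by rewrite divr_gt0// exprn_gt0.
have [N _ hN] : \forall n \near \oo, rnorm v ^+ 2 - S v n < e ^+ 2 / 4.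
  have vs : cvgn (series (fun n => rnorm (v n) ^+ 2)) := @l2P _ _ v.
  have /cvgrPdist_lt /(_ _ e2) := vs; apply: filterS => n.
  by rewrite -l2_sqrE seriesE => /ltr_normlW.
exists N => n /hN h; apply: (@le_lt_trans _ _ (e / 2)); last lra.
apply: l2_rnorm_le => [|m]; first by rewrite divr_ge0// ltW.
rewrite (_ : (e / 2) ^+ 2 = e ^+ 2 / 4); last by field.
apply: le_trans (ltW h); rewrite lerBrDr (le_trans _ (l2_psum_ub v (m + n)))//.
rewrite /S -!(big_mkord xpredT (fun i => rnorm (_ i) ^+ 2)).
have mono (a b : nat) (F : nat -> R) : (a <= b)%N -> (forall i, 0 <= F i) ->
    \sum_(0 <= i < a) F i <= \sum_(0 <= i < b) F i.
  by move=> ab F0; rewrite (big_cat_nat (leq0n a) ab) /= lerDl sumr_ge0.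
apply: le_trans (_ : \sum_(0 <= i < m + n) rnorm ((v - truncation v n) i) ^+ 2 +
  \sum_(0 <= i < m + n) (if (i < n)%N then rnorm (v i) ^+ 2 else 0) <= _).
  apply: lerD; first by apply: mono; [exact: leq_addr|move=> i; exact: sqr_ge0].
  rewrite (eq_big_nat _ _ (F2 := fun i => if (i < n)%N then rnorm (v i) ^+ 2 else 0)).
    by apply: mono => [|i]; [exact: leq_addl|case: ifP => // _; exact: sqr_ge0].
  by move=> i /andP[_ ->].
rewrite -big_split /=; apply: ler_sum => i _.
rewrite -[X in rnorm X ^+ 2 + _]/(v i - truncation v n i) truncationE; case: ifP => _.
  by rewrite subrr rnorm0 expr0n add0r.
by rewrite subr0 addr0.
Qed.

(** A bounded operator that moves basis vectors upwards is given by the entries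
    of its matrix, the sums being finite. *)
Lemma lower_triangularE (T : BL (l2 H)) v i :
  (forall xi k j, (j < k)%N -> T (tensor xi k) j = 0) ->
  T v i = \sum_(k < i.+1) T (tensor (v k) k) i.
Proof.
move=> Tlow; apply/eqP; rewrite -subr_eq0; apply/eqP; apply: rnorm_small => e e0.
have T0 : 0 < rnorm T + 1 by rewrite ltr_wpDl ?rnorm_ge0.
have [N hN] := truncation_cvg v (divr_gt0 e0 T0).
have {}hN := hN _ (leq_addl i.+1 N).
have -> : \sum_(k < i.+1) T (tensor (v k) k) i = T (truncation v (i.+1 + N)%N) i.
  rewrite /truncation BL_sum l2_sumE big_split_ord /= [X in _ + X]big1 ?addr0//.
  by move=> k _; apply: Tlow; rewrite /= ltnS leq_addr.
rewrite -l2_subE -BLB (le_trans (l2_coord_ub _ _))// (le_trans (BL_rnorm_ub _ _))//.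
move/ltW: hN; rewrite ler_pdivlMr// mulrC; apply: le_trans.
by rewrite ler_wpM2r ?rnorm_ge0// lerDl.
Qed.

End l2_theory.

(** * Symbols: the matrix of an element of the semicrossed product *)

Section symbols.
Context {R : realType} {X : topologicalType} (phi : homeomorphism X).
Context {H : normedModType R[i]} {dotp : {dot H for Num.conj}}.
Context (dotp_norm : forall x : H, `|x| ^+ 2 = dotp x x).
Context {sigma : C0 R X -> BL H}.
Context (sigma_rep : faithful_representation dotp sigma).
Implicit Types (f g : C0 R X) (xi : H) (F G : nat -> C0 R X) (S T : BL (l2 H)).

Local Notation alpha := (alpha phi).
Local Notation repD := (rep_additive sigma_rep).
Local Notation rep0 := (rep0 sigma_rep).
Local Notation repZ := (rep_scale sigma_rep).
Local Notation repM := (rep_mulE sigma_rep).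

Lemma alpha_add k j f : alpha k (alpha j f) = alpha (j + k) f.
Proof. by apply: C0_ext => x; rewrite /= iterD. Qed.

Lemma alphaD k f g : alpha k (f + g) = alpha k f + alpha k g.
Proof. exact: C0_ext. Qed.

Lemma alphaZ k (a : R[i]) f : alpha k (a *: f) = a *: alpha k f.
Proof. exact: C0_ext. Qed.

Lemma alpha0 k : alpha k (0 : C0 R X) = 0.
Proof. exact: C0_ext. Qed.

Lemma alphaM k f g : alpha k (C0_mul f g) = C0_mul (alpha k f) (alpha k g).
Proof. exact: C0_ext. Qed.

Lemma alpha_sum k (I : Type) (r : seq I) (P : pred I) (F : I -> C0 R X) :
  alpha k (\sum_(i <- r | P i) F i) = \sum_(i <- r | P i) alpha k (F i).
Proof. by elim/big_rec2 : _ => [|i x y _ <-]; rewrite ?alpha0 ?alphaD. Qed.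

Lemma alpha_rnorm k f : rnorm (alpha k f) <= rnorm f.
Proof. by apply: C0_rnorm_le => [|x]; [exact: rnorm_ge0|exact: (C0_rnorm_ub f)]. Qed.

Lemma rep_sum (I : Type) (r : seq I) (P : pred I) (F : I -> C0 R X) :
  sigma (\sum_(i <- r | P i) F i) = \sum_(i <- r | P i) sigma (F i).
Proof. by elim/big_rec2 : _ => [|i x y _ <-]; rewrite ?rep0 ?repD. Qed.

Lemma rep_alpha_ub k f xi : rnorm (sigma (alpha k f) xi) <= rnorm f * rnorm xi.
Proof.
rewrite (le_trans (rep_contractive dotp_norm sigma_rep _ _))//.
by rewrite ler_wpM2r ?rnorm_ge0// alpha_rnorm.
Qed.

(** The (i, k) entry of the matrix of the operator with Fourier coefficients
    [F] is [alpha^k (F (i - k))], below the diagonal. *)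
Definition symbol F T := forall xi k i,
  T (tensor xi k) i = if (k <= i)%N then sigma (alpha k (F (i - k)%N)) xi else 0.

Lemma symbolE F T (v : l2 H) i : symbol F T ->
  T v i = \sum_(k < i.+1) sigma (alpha k (F (i - k)%N)) (v k).
Proof.
move=> FT; rewrite lower_triangularE; last first.
  by move=> xi k j jk; rewrite FT leqNgt jk.
by apply: eq_bigr => k _; rewrite FT -ltnS ltn_ord.
Qed.

Lemma symbol_eq F S T : symbol F S -> symbol F T -> S = T.
Proof. by move=> FS FT; apply: BL_ext => v; apply: l2_ext => i; rewrite !(@symbolE F). Qed.

Lemma symbol_col0 F T xi n : symbol F T -> T (tensor xi 0) n = sigma (F n) xi.
Proof.
by move=> ->; rewrite leq0n subn0; congr (sigma _ _); apply: C0_ext.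
Qed.

Lemma symbol_unique F G T : symbol F T -> symbol G T -> F = G.
Proof.
move=> FT GT; apply/funext => n; apply: (rep_eq sigma_rep) => xi.
by rewrite -(symbol_col0 xi n FT) (symbol_col0 xi n GT).
Qed.

Lemma symbol0 : symbol (fun=> 0) 0.
Proof. by move=> xi k i; rewrite alpha0 rep0 if_same. Qed.

Lemma symbolD F G S T : symbol F S -> symbol G T -> symbol (fun n => F n + G n) (S + T).
Proof.
move=> FS GT xi k i; rewrite BL_addE l2_addE FS GT.
by case: ifP => _; rewrite ?addr0// alphaD repD.
Qed.

Lemma symbolZ (a : R[i]) F T : symbol F T -> symbol (fun n => a *: F n) (a *: T).
Proof.
move=> FT xi k i; rewrite BL_scaleE l2_scaleE FT.
by case: ifP => _; rewrite ?scaler0// alphaZ repZ.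
Qed.

Lemma symbolB F G S T : symbol F S -> symbol G T -> symbol (fun n => F n - G n) (S - T).
Proof.
move=> FS /(symbolZ (-1)) /(symbolD FS); rewrite scaleN1r.
by under [X in symbol X]eq_fun do rewrite scaleN1r.
Qed.

Lemma symbol_sum (I : Type) (r : seq I) (F : I -> nat -> C0 R X) (T : I -> BL (l2 H)) :
  (forall i, symbol (F i) (T i)) ->
  symbol (fun n => \sum_(i <- r) F i n) (\sum_(i <- r) T i).
Proof.
move=> FT; elim: r => [|a r IH].
  by rewrite big_nil; under eq_fun do rewrite big_nil; exact: symbol0.
by rewrite big_cons; under eq_fun do rewrite big_cons; exact: (symbolD (FT a) IH).
Qed.

Lemma rnorm_tensor xi k : rnorm (tensor xi k) <= rnorm xi.
Proof.
apply: l2_rnorm_le => [|n]; first exact: rnorm_ge0.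
apply: (@le_trans _ _ (\sum_(i < n) if (i == k :> nat) then rnorm xi ^+ 2 else 0)).
  by apply: ler_sum => i _ /=; case: ifP => // _; rewrite rnorm0 expr0n.
have [kn|nk] := ltnP k n.
  rewrite (bigD1 (Ordinal kn))//= eqxx big1 ?addr0// => i.
  by rewrite -val_eqE /= => /negbTE ->.
rewrite big1 ?sqr_ge0// => i _; case: eqVneq => // ik.
by have := ltn_ord i; rewrite ik ltnNge nk.
Qed.

Lemma symbol_contractive F T n : symbol F T -> rnorm (F n) <= rnorm T.
Proof.
move=> FT; apply: (rep_isometric dotp_norm sigma_rep); first exact: rnorm_ge0.
move=> xi; rewrite -(symbol_col0 xi n FT) (le_trans (l2_coord_ub _ _))//.
rewrite (le_trans (BL_rnorm_ub _ _))// ler_wpM2l ?rnorm_ge0//.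
exact: rnorm_tensor.
Qed.

Lemma rep_sub_ub f g k xi :
  rnorm (sigma (alpha k f) xi - sigma (alpha k g) xi) <= rnorm (f - g) * rnorm xi.
Proof.
rewrite -BL_oppE -BL_addE -scaleN1r -repZ -alphaZ -repD -alphaD scaleN1r.
exact: rep_alpha_ub.
Qed.

(** Fourier coefficients pass to norm limits because C_0(X) is complete. *)
Lemma symbol_closed T :
  (forall e : R, 0 < e -> exists S F, symbol F S /\ rnorm (T - S) < e) ->
  exists F, symbol F T.
Proof.
move=> hT; pose d (j : nat) : R := j.+1%:R^-1.
have d0 j : 0 < d j by rewrite invr_gt0.
have dlim (e : R) : 0 < e -> exists j, d j < e.
  move=> e0; have [n _ /(_ n (leqnn n))] := near_infty_natSinv_lt (PosNum e0).
  by move=> /= h; exists n.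
have /choice[S /choice[F SF]] : forall j, exists S F, symbol F S /\ rnorm (T - S) < d j.
  by move=> j; exact: hT.
have /choice[G FG] : forall n, exists f, forall j, rnorm (F j n - f) <= 2 * d j.
  move=> n; apply: C0_complete => // j k.
  apply: le_trans (symbol_contractive n (symbolB (SF j).1 (SF k).1)) _.
  apply: le_trans (rnorm_tri _ T _) _.
  by rewrite rnormB lerD// ltW//; case: (SF j); case: (SF k).
exists G => xi k i; apply/eqP; rewrite -subr_eq0; apply/eqP/rnorm_small => e e0.
have x0 : 0 < 3 * (rnorm xi + 1) by rewrite mulr_gt0// ltr_wpDl ?rnorm_ge0.
have [j dj] := dlim _ (divr_gt0 e0 x0).
apply: (@le_trans _ _ (3 * (rnorm xi + 1) * d j)); last first.
  by move: dj; rewrite ltr_pdivlMr// mulrC => /ltW.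
apply: le_trans (rnorm_tri _ (S j (tensor xi k) i) _) _.
have h1 : rnorm (T (tensor xi k) i - S j (tensor xi k) i) <= d j * rnorm xi.
  rewrite -l2_subE -[X in l2_fun X]/((T - S j) (tensor xi k)).
  rewrite (le_trans (l2_coord_ub _ _))// (le_trans (BL_rnorm_ub _ _))//.
  by rewrite ler_pM ?rnorm_ge0 ?rnorm_tensor// ltW// (SF j).2.
have h2 : rnorm (S j (tensor xi k) i -
    (if (k <= i)%N then sigma (alpha k (G (i - k)%N)) xi else 0)) <= 2 * d j * rnorm xi.
  rewrite (SF j).1; case: ifP => _; last first.
    by rewrite subrr rnorm0 mulr_ge0 ?rnorm_ge0// mulr_ge0// ltW.
  by rewrite (le_trans (rep_sub_ub _ _ _ _))// ler_wpM2r ?rnorm_ge0.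
have := d0 j; have := rnorm_ge0 xi; nra.
Qed.

Definition convolution F G n : C0 R X :=
  \sum_(j < n.+1) C0_mul (alpha j (F (n - j)%N)) (G j).

Lemma symbol_comp F G S T : symbol F S -> symbol G T ->
  symbol (convolution F G) (BL_comp S T).
Proof.
move=> FS GT xi l i; rewrite BL_compE (symbolE _ _ FS).
pose B k := if (l <= k)%N then
  sigma (alpha k (F (i - k)%N)) (sigma (alpha l (G (k - l)%N)) xi) else 0.
rewrite (eq_bigr (fun k : 'I_i.+1 => B k)) => [|k _]; last first.
  by rewrite GT /B; case: ifP => _; rewrite ?BL0.
rewrite -(big_mkord xpredT B) /B.
case: leqP => [li|il]; last first.
  rewrite big_nat big1// => k /andP[_ ki].
  by rewrite leqNgt (leq_trans _ il).
rewrite (big_cat_nat (leq0n l) (leqW li)) /= big_nat big1 ?add0r; last first.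
  by move=> k /andP[_ kl]; rewrite leqNgt kl.
rewrite -{1}(add0n l) big_addn subSn// big_mkord.
rewrite /convolution alpha_sum rep_sum BL_sumE; apply: eq_bigr => j _.
rewrite leq_addl addnK -repM alphaM; congr (sigma (C0_mul _ _) _).
by rewrite alpha_add [(j + l)%N]addnC subnDA.
Qed.


Section Umonomial.
Context (n : nat) (f : C0 R X).

Let m_fun (v : l2 H) (i : nat) : H :=
  if (n <= i)%N then sigma (alpha (i - n) f) (v (i - n)%N) else 0.

Let m_psum v m : \sum_(i < m) rnorm (m_fun v i) ^+ 2 <= (rnorm f * rnorm v) ^+ 2.
Proof.
apply: (@le_trans _ _ (\sum_(i < n + m) rnorm (m_fun v i) ^+ 2)).
  rewrite addnC big_split_ord /= lerDl; apply: sumr_ge0 => i _; exact: sqr_ge0.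
rewrite big_split_ord /= big1 ?add0r; last first.
  by move=> i _; rewrite /m_fun leqNgt ltn_ord rnorm0 expr0n.
apply: (@le_trans _ _ (\sum_(i < m) rnorm f ^+ 2 * rnorm (v i) ^+ 2)).
  apply: ler_sum => i _; rewrite /m_fun leq_addr addKn -exprMn.
  by rewrite ler_sqr ?nnegrE ?mulr_ge0 ?rnorm_ge0// rep_alpha_ub.
by rewrite -mulr_sumr exprMn ler_wpM2l ?sqr_ge0// l2_psum_ub.
Qed.

Let m_l2 (v : l2 H) : l2 H := MkL2 (l2_construct (m_psum v)).

Let m_bounded v : rnorm (m_l2 v) <= rnorm f * rnorm v.
Proof.
by apply: l2_rnorm_le => [|k]; [rewrite mulr_ge0 ?rnorm_ge0|exact: m_psum].
Qed.

Let m_linear : linear m_l2.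
Proof.
move=> a u v; apply: l2_ext => i.
rewrite -[RHS]/(a *: m_fun u i + m_fun v i) -[LHS]/(m_fun (a *: u + v) i) /m_fun.
by case: ifP => _; [rewrite BLD BL_linearZ|rewrite scaler0 addr0].
Qed.

(** The operator [U^n f]. *)
Definition Umonomial : BL (l2 H) := MkBL (BL_construct m_linear m_bounded).

Lemma monomial_rnorm : rnorm Umonomial <= rnorm f.
Proof.
apply: BL_rnorm_le => [|v]; first exact: rnorm_ge0.
exact: (m_bounded v).
Qed.

Lemma symbol_monomial : symbol (fun m => if m == n then f else 0) Umonomial.
Proof.
move=> xi k i; rewrite -[LHS]/(m_fun (tensor xi k) i) /m_fun tensorE.
have [ni|ni] := leqP n i; have [ki|ki] := leqP k i => //.
- have -> : (i - k == n)%N = (i - n == k)%N.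
    by rewrite -(eqn_add2r k) subnK// -(eqn_add2r n (i - n)) subnK// addnC.
  by case: eqP => [->|_]; rewrite // BL0 alpha0 rep0.
- case: eqP => [ink|_]; last by rewrite BL0.
  by have := leq_subr n i; rewrite ink leqNgt ki.
- case: eqP => [ikn|_]; last by rewrite alpha0 rep0.
  by have := leq_subr k i; rewrite ikn leqNgt ni.
Qed.

End Umonomial.

Lemma monomialD n f g : Umonomial n (f + g) = Umonomial n f + Umonomial n g.
Proof.
apply: symbol_eq (symbol_monomial _ _) _.
have := symbolD (symbol_monomial n f) (symbol_monomial n g).
by congr symbol; apply/funext => m; case: ifP; rewrite ?addr0.
Qed.

Lemma monomialZ n (a : R[i]) f : Umonomial n (a *: f) = a *: Umonomial n f.
Proof.
apply: symbol_eq (symbol_monomial _ _) _.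
have := symbolZ a (symbol_monomial n f).
by congr symbol; apply/funext => m; case: ifP; rewrite ?scaler0.
Qed.

Lemma monomial0 n : Umonomial n 0 = 0.
Proof. by rewrite -(scale0r (0 : C0 R X)) monomialZ scale0r. Qed.

Lemma monomialB n f g : Umonomial n (f - g) = Umonomial n f - Umonomial n g.
Proof. by rewrite -scaleN1r monomialD monomialZ scaleN1r. Qed.

(** The covariance relation of the semicrossed product. *)
Lemma monomialM n m f g : BL_comp (Umonomial n f) (Umonomial m g) =
  Umonomial (n + m) (C0_mul (alpha m f) g).
Proof.
apply: symbol_eq (symbol_comp (symbol_monomial _ _) (symbol_monomial _ _)) _.
have := symbol_monomial (n + m) (C0_mul (alpha m f) g).
congr symbol; apply/funext => k; rewrite /convolution.
have mul0 h : C0_mul h 0 = 0 by apply: C0_ext => x; exact: mulr0.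
have [mk|km] := leqP m k; last first.
  rewrite big1 => [|j _].
    by case: eqP => // E; move: km; rewrite E ltnNge leq_addl.
  by rewrite (ltn_eqF (leq_ltn_trans _ km)) ?mul0// -ltnS ltn_ord.
have mk1 : (m < k.+1)%N by [].
rewrite (bigD1 (Ordinal mk1)) //= eqxx big1 ?addr0; last first.
  by move=> j; rewrite -val_eqE /= => /negbTE ->; exact: mul0.
rewrite -(eqn_add2r m (k - m)) subnK//; case: eqP => // _.
by apply: C0_ext => x; rewrite /= mul0r.
Qed.

(** * Polynomials, and the semicrossed product as their closure *)

Definition Upolynomial (s : seq (nat * C0 R X)) : BL (l2 H) :=
  \sum_(p <- s) Umonomial p.1 p.2.

Lemma polynomial_symbol s : exists F N, symbol F (Upolynomial s) /\
  forall n, (N <= n)%N -> F n = 0.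
Proof.
exists (fun n => \sum_(p <- s) if n == p.1 then p.2 else 0).
exists (\max_(p <- s) p.1).+1; split.
  apply: (@symbol_sum _ s (fun (p : nat * C0 R X) n => if n == p.1 then p.2 else 0)).
  by move=> p; exact: symbol_monomial.
move=> n; rewrite ltnNge => nN; rewrite big_seq big1// => p ps.
case: eqP => // np; case/negP: nN; rewrite np.
exact: (@leq_bigmax_seq _ s xpredT (fun p => p.1) p ps isT).
Qed.

Lemma symbol_polynomial F N T : symbol F T -> (forall n, (N <= n)%N -> F n = 0) ->
  T = \sum_(n < N) Umonomial n (F n).
Proof.
move=> FT F0; apply: symbol_eq FT _.
have := symbol_sum (index_enum 'I_N) (fun n : 'I_N => symbol_monomial n (F n)).
congr symbol; apply/funext => n.
have [Nn|nN] := leqP N n.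
  rewrite F0// big1// => i _; case: eqP => // ni.
  by have := ltn_ord i; rewrite -ni ltnNge Nn.
rewrite (bigD1 (Ordinal nN)) //= eqxx big1 ?addr0// => i.
by rewrite -val_eqE /= eq_sym => /negbTE ->.
Qed.

Lemma tensor_series (u : nat -> H) k M i :
  series (fun n => tensor (u n) (k + n)%N) M i =
  if (k <= i < k + M)%N then u (i - k)%N else 0.
Proof.
rewrite seriesEnat /= big_mkord l2_sumE.
have [ki|ik] := leqP k i; last first.
  rewrite big1// => n _; rewrite tensorE; case: eqP => // E.
  by move: ik; rewrite E ltnNge leq_addr.
rewrite andTb -ltn_subLR//; have [iM|Mi] := ltnP.
  rewrite (bigD1 (Ordinal iM))// big1 /= ?addr0 ?subnKC ?eqxx// => n.
  by rewrite -val_eqE /= -(eqn_add2l k) subnKC// eq_sym => /negbTE ->.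
rewrite big1// => n _; rewrite tensorE; case: eqP => // E.
by have := ltn_ord n; rewrite ltnNge (leq_trans Mi)// E addKn.
Qed.

Lemma represents_symbol F T : represents phi sigma F T -> symbol F T.
Proof.
move=> FT xi k i; apply/eqP; rewrite -subr_eq0; apply/eqP/rnorm_small => e e0.
have /cvgn_rnormP/(_ _ e0)[N /(_ _ (leq_addl i.+1 N))] := FT xi k.
set s := series _ => h.
have := l2_coord_ub (T (tensor xi k) - s (i.+1 + N)%N) i.
rewrite l2_subE tensor_series addnA ltn_addr ?andbT; last first.
  by rewrite addnS ltnS leq_addl.
by move=> /le_trans; apply; exact: ltW.
Qed.

Lemma symbol_represents F T N : symbol F T -> (forall n, (N <= n)%N -> F n = 0) ->
  ell1 F /\ represents phi sigma F T.
Proof.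
move=> FT F0; split.
  apply/cvg_ex; exists (series (fun n => rnorm (F n)) N).
  apply/cvgrPdist_lt => e e0; exists N => // n /= Nn.
  have tail0 : \sum_(N <= i < n) rnorm (F i) = 0.
    by rewrite big_nat big1// => i /andP[/F0 -> _]; rewrite rnorm0.
  by rewrite !seriesEnat /= (big_cat_nat (leq0n N) Nn) /= tail0 addr0 subrr normr0.
move=> xi k; apply/cvgn_rnormP => e e0; exists N => n Nn.
rewrite (_ : T _ - _ = 0) ?rnorm0//; apply: l2_ext => i.
rewrite l2_subE tensor_series FT.
have [ki|ik] := leqP k i; last by rewrite subrr.
rewrite andTb; case: ltnP => ni; first by rewrite subrr.
by rewrite F0 ?alpha0 ?rep0 ?subrr// leq_subRL// (leq_trans _ ni)// leq_add2l.
Qed.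

Local Notation A := (semicrossed_product phi sigma).

Lemma polynomial_mem s : A (Upolynomial s).
Proof.
have [F [N [FT F0]]] := polynomial_symbol s.
by apply: subset_closure; exists F; have [] := symbol_represents FT F0.
Qed.

(** The partial sums of an absolutely convergent series converge in norm: the
    tail is controlled coordinatewise, where it is a finite sum. *)
Lemma ell1_polynomial F T (e : R) : ell1 F -> represents phi sigma F T -> 0 < e ->
  exists s, rnorm (T - Upolynomial s) <= e.
Proof.
move=> Fell /represents_symbol FT e0.
have [N hN] : exists N, forall M, (N <= M)%N -> \sum_(N <= n < M) rnorm (F n) <= e.
  have /cauchy_cvgP/cauchy_seriesP/(_ _ e0)[[P Q] /= [[N1 _ hP] [N2 _ hQ]] PQ] := Fell.
  exists (maxn N1 N2) => M NM.
  have /PQ /= : (P `*` Q) (maxn N1 N2, M).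
    by split=> /=; [apply: hP|apply: hQ]; rewrite /= ?leq_maxl// (leq_trans _ NM)// leq_maxr.
  by move=> /ltW; apply: le_trans; exact: ler_norm.
exists [seq (n, F n) | n <- index_iota 0 N].
rewrite /Upolynomial big_map; set S := \sum_(_ <- _) _.
have SS M : symbol (fun n => if (n < M)%N then F n else 0)
    (\sum_(n <- index_iota 0 M) Umonomial n (F n)).
  have := symbol_sum (index_iota 0 M) (fun n => symbol_monomial n (F n)).
  congr symbol; apply/funext => n; rewrite big_mkord; case: ltnP => nM.
    rewrite (bigD1 (Ordinal nM)) //= eqxx big1 ?addr0// => i.
    by rewrite -val_eqE /= eq_sym => /negbTE ->.
  rewrite big1// => i _; case: eqP => // ni.
  by have := ltn_ord i; rewrite -ni ltnNge nM.
apply: BL_rnorm_le => [|v]; first exact: ltW.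
apply: l2_rnorm_le => [|m]; first by rewrite mulr_ge0 ?rnorm_ge0 ?ltW.
pose D := \sum_(N <= n < N + m) Umonomial n (F n).
have DE : D = \sum_(n <- index_iota 0 (N + m)) Umonomial n (F n) - S.
  by rewrite /D /S (big_cat_nat (leq0n N) (leq_addr m N)) /= addrAC subrr add0r.
rewrite (eq_bigr (fun i : 'I_m => rnorm (D v i) ^+ 2)) => [|i _]; last first.
  rewrite (symbolE _ _ (symbolB FT (SS N))) DE (symbolE _ _ (symbolB (SS (N + m)%N) (SS N))).
  congr (rnorm _ ^+ 2); apply: eq_bigr => k _; congr (sigma (alpha _ (_ - _)) _).
  by rewrite (leq_ltn_trans (leq_subr _ _))// (leq_trans (ltn_ord i))// leq_addl.
apply: (le_trans (l2_psum_ub _ _)).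
rewrite ler_sqr ?nnegrE ?mulr_ge0 ?rnorm_ge0 ?(ltW e0)//.
rewrite (le_trans (BL_rnorm_ub _ _))// ler_wpM2r ?rnorm_ge0//.
apply: le_trans (hN _ (leq_addr m N)); apply: le_trans (rnorm_sum _ _ _) _.
by apply: ler_sum => n _; exact: monomial_rnorm.
Qed.

(** Finite sums of monomials are already dense, and their products are given by
    the covariance relation. *)
Lemma semicrossed_approx T : A T <->
  forall e : R, 0 < e -> exists s, rnorm (T - Upolynomial s) < e.
Proof.
split=> [/closure_rnormP AT e e0|AT].
  have e2 : 0 < e / 2 by rewrite divr_gt0.
  have [S [F Fell FS] TS] := AT _ e2.
  have [s hs] := ell1_polynomial Fell FS e2; exists s.
  by rewrite (le_lt_trans (rnorm_tri _ S _))//; lra.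
apply: (@closed_closure _ _); apply/closure_rnormP => e /AT[s hs].
by exists (Upolynomial s) => //; exact: polynomial_mem.
Qed.

Lemma semicrossed_symbol T : A T -> exists F, symbol F T.
Proof.
move=> /semicrossed_approx AT; apply: symbol_closed => e /AT[s hs].
by have [F [N [Fs _]]] := polynomial_symbol s; exists (Upolynomial s), F.
Qed.

Lemma fourier_graph_approx n T f : fourier_graph phi sigma n (T, f) <->
  forall e : R, 0 < e -> exists S F, [/\ ell1 F, represents phi sigma F S,
    rnorm (T - S) < e & rnorm (f - F n) < e].
Proof.
split=> [Tf e e0|Tf B [[P Q] /= [/nbhs_rnormP[d d0 dP] /nbhs_rnormP[e e0 eQ]] PQ]].
  have /Tf[[S g] /= [[F Fell [FS gF]] [/= TS fg]]] :
      nbhs (T, f) ([set S | rnorm (T - S) < e] `*` [set g | rnorm (f - g) < e]).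
    by exists ([set S | rnorm (T - S) < e], [set g | rnorm (f - g) < e]) => //;
      split; apply/nbhs_rnormP; exists e.
  by exists S, F; split=> //; move: fg; rewrite gF.
have de0 : 0 < Num.min d e by rewrite lt_min d0.
have [S [F [Fell FS]]] := Tf _ de0; rewrite !lt_min => /andP[TS _] /andP[_ fF].
exists (S, F n); split; first by exists F.
by apply: PQ; split; [exact: dP|exact: eQ].
Qed.

(** The coefficient map is contractive where it is defined, so the closure of its
    graph has one point above [T]: the coefficient read off the matrix of [T]. *)
Lemma symbol_fourier F T n : A T -> symbol F T -> fourier_coef phi sigma n T = F n.
Proof.
move=> AT FT; apply: xget_unique.
  apply/fourier_graph_approx => e e0; have /semicrossed_approx/(_ _ e0)[s hs] := AT.
  have [G [N [Gs G0]]] := polynomial_symbol s.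
  have [Gell Gr] := symbol_represents Gs G0; exists (Upolynomial s), G; split=> //.
  exact: le_lt_trans (symbol_contractive n (symbolB FT Gs)) hs.
move=> f /fourier_graph_approx Tf; apply/eqP; rewrite -subr_eq0; apply/eqP/rnorm_small => e e0.
have e2 : 0 < e / 2 by rewrite divr_gt0.
have [S [G [Gell /represents_symbol GS TS fG]]] := Tf _ e2.
have h := symbol_contractive n (symbolB FT GS).
apply: le_trans (rnorm_tri f (G n) (F n)) _.
rewrite (splitr e); apply: lerD; first exact: (ltW fG).
rewrite (rnormB (G n) (F n)); apply: le_trans h _; exact: (ltW TS).
Qed.

End symbols.

(** * Cesaro means of the Fourier series *)

Section finite_sums.
Context {R : realType}.

Lemma sqr_sum_le N (a : nat -> R) :
  (\sum_(j < N) a j) ^+ 2 <= N%:R * \sum_(j < N) a j ^+ 2.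
Proof.
elim: N => [|N IH]; first by rewrite !big_ord0 expr0n mulr0.
rewrite !big_ord_recr /=; move: IH.
set s := \sum_(j < N) _; set q := \sum_(j < N) _; set b := a N => IH.
have [NE|N0] := posnP N.
  have s0 : s = 0 by move: IH; rewrite NE mul0r => h; apply/eqP; rewrite -sqrf_eq0 eq_le h sqr_ge0.
  have q0 : 0 <= q by apply: sumr_ge0 => j _; exact: sqr_ge0.
  by rewrite s0 NE add0r mul1r lerDr.
rewrite -natr1; have Np : 0 < N%:R :> R by rewrite ltr0n.
rewrite -(ler_pM2l Np); have := sqr_ge0 (s - N%:R * b); nra.
Qed.

Lemma sum_prefix (V : nmodType) (c N : nat) (x : V) : (c <= N)%N ->
  \sum_(j < N) (if (j < c)%N then x else 0) = x *+ c.
Proof.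
move=> cN; rewrite -big_mkcond -(big_ord_widen N (fun=> x) cN).
by rewrite sumr_const card_ord.
Qed.

Lemma sum_shift_le (g : nat -> R) i N m : (forall k, 0 <= g k) -> (i <= m)%N ->
  \sum_(j < N) g (i + j)%N <= \sum_(r < m + N) g r.
Proof.
move=> g0 im; have -> : (m + N = i + N + (m - i))%N by rewrite addnAC subnKC.
rewrite !big_split_ord /= -addrA; have s0 n k : 0 <= \sum_(j < n) g (k + j)%N.
  by apply: sumr_ge0.
rewrite -[leLHS]add0r lerD ?sumr_ge0// lerDl; exact: s0.
Qed.

Lemma sum_window_le (a : R) k N M : 0 <= a ->
  \sum_(r < M) (if (k <= r < k + N)%N then a else 0) <= N%:R * a.
Proof.
move=> a0; apply: (@le_trans _ _ (\sum_(r < k + (N + M))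
    (if (k <= r < k + N)%N then a else 0))).
  rewrite addnA (addnC (k + N)%N) big_split_ord /= lerDl.
  by apply: sumr_ge0 => r _; case: ifP.
rewrite !big_split_ord /= big1 ?add0r => [|r _]; last by rewrite leqNgt ltn_ord.
rewrite [X in _ + X]big1 ?addr0 => [|r _]; last first.
  by rewrite ltn_add2l ltnNge !leq_addr.
rewrite (eq_bigr (fun=> a)) => [|r _]; last by rewrite leq_addr ltn_add2l ltn_ord.
by rewrite sumr_const card_ord mulr_natl.
Qed.

End finite_sums.

Section semicrossed_algebra.
Context {R : realType} {X : topologicalType} {phi : homeomorphism X}.
Context {H : normedModType R[i]} {dotp : {dot H for Num.conj}}.
Context (dotp_norm : forall x : H, `|x| ^+ 2 = dotp x x).
Context {sigma : C0 R X -> BL H}.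
Context (sigma_rep : faithful_representation dotp sigma).
Implicit Types (f g : C0 R X) (xi : H) (F G : nat -> C0 R X) (S T W : BL (l2 H)).

Local Notation alpha := (alpha phi).
Local Notation symb := (@symbol R X phi H sigma).
Local Notation A := (semicrossed_product phi sigma).
Local Notation U := (Umonomial phi dotp_norm sigma_rep).
Local Notation P := (Upolynomial phi dotp_norm sigma_rep).

Lemma monomial_mem n f : A (U n f).
Proof.
have := @polynomial_mem _ _ phi _ _ dotp_norm _ sigma_rep [:: (n, f)].
by rewrite /Upolynomial big_seq1.
Qed.

Lemma semicrossed0 : A 0.
Proof.
by have := @polynomial_mem _ _ phi _ _ dotp_norm _ sigma_rep [::]; rewrite /Upolynomial big_nil.
Qed.

Lemma semicrossed_linear (a : R[i]) S T : A S -> A T -> A (a *: S + T).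
Proof.
move=> /(semicrossed_approx phi dotp_norm sigma_rep) AS.
move=> /(semicrossed_approx phi dotp_norm sigma_rep) AT.
apply/(semicrossed_approx phi dotp_norm sigma_rep) => e e0.
have a0 : 0 < rnorm (a : R[i]^o) + 1 by rewrite ltr_wpDl ?rnorm_ge0.
have e2 : 0 < e / 2 by rewrite divr_gt0.
have [s hs] := AS _ (divr_gt0 e2 a0); have [t ht] := AT _ e2.
exists ([seq (p.1, a *: p.2) | p <- s] ++ t).
have -> : P ([seq (p.1, a *: p.2) | p <- s] ++ t) = a *: P s + P t.
  rewrite /Upolynomial big_cat big_map scaler_sumr /=; congr (_ + _).
  by apply: eq_bigr => p _; rewrite monomialZ.
have -> : a *: S + T - (a *: P s + P t) = a *: (S - P s) + (T - P t).
  by rewrite scalerBr opprD addrACA.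
rewrite (le_lt_trans (rnormD _ _))// rnormZ.
have : rnorm (a : R[i]^o) * rnorm (S - P s) <= e / 2.
  rewrite (@le_trans _ _ ((rnorm (a : R[i]^o) + 1) * rnorm (S - P s)))//.
    by rewrite ler_wpM2r ?rnorm_ge0// lerDl.
  by move: hs; rewrite ltr_pdivlMr// mulrC => /ltW.
by move=> h; rewrite [ltRHS](splitr e) ler_ltD.
Qed.

Lemma semicrossed_comp S T : A S -> A T -> A (BL_comp S T).
Proof.
move=> /(semicrossed_approx phi dotp_norm sigma_rep) AS.
move=> /(semicrossed_approx phi dotp_norm sigma_rep) AT.
apply/(semicrossed_approx phi dotp_norm sigma_rep) => e e0.
have e2 : 0 < e / 2 by rewrite divr_gt0.
have T0 : 0 < rnorm T + 1 by rewrite ltr_wpDl ?rnorm_ge0.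
have [s hs] := AS _ (divr_gt0 e2 T0).
have P0 : 0 < rnorm (P s) + 1 by rewrite ltr_wpDl ?rnorm_ge0.
have [t ht] := AT _ (divr_gt0 e2 P0).
exists [seq ((p.1 + q.1)%N, C0_mul (alpha q.1 p.2) q.2) | p <- s, q <- t].
have -> : P [seq ((p.1 + q.1)%N, C0_mul (alpha q.1 p.2) q.2) | p <- s, q <- t] =
    BL_comp (P s) (P t).
  rewrite /Upolynomial big_allpairs_dep /=; apply: BL_ext => x.
  rewrite BL_compE [LHS]BL_sumE [RHS]BL_sumE; apply: eq_bigr => p _.
  by rewrite !BL_sumE BL_sum; apply: eq_bigr => q _; rewrite -monomialM.
have -> : BL_comp S T - BL_comp (P s) (P t) =
    BL_comp (S - P s) T + BL_comp (P s) (T - P t).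
  by rewrite BL_compBl BL_compBr addrA subrK.
rewrite (le_lt_trans (rnormD _ _))//.
have h1 : rnorm (BL_comp (S - P s) T) <= e / 2.
  apply: le_trans (BL_comp_rnorm _ _) _.
  rewrite (@le_trans _ _ (rnorm (S - P s) * (rnorm T + 1)))//.
    by rewrite ler_wpM2l ?rnorm_ge0// lerDl.
  by move: hs; rewrite ltr_pdivlMr// => /ltW.
have h2 : rnorm (BL_comp (P s) (T - P t)) < e / 2.
  apply: le_lt_trans (BL_comp_rnorm _ _) _.
  rewrite (@le_lt_trans _ _ ((rnorm (P s) + 1) * rnorm (T - P t)))//.
    by rewrite ler_wpM2r ?rnorm_ge0// lerDl.
  by move: ht; rewrite ltr_pdivlMr// mulrC.
by rewrite [ltRHS](splitr e) ler_ltD.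
Qed.

(** A Riemann-Lebesgue lemma: it is clear for polynomials, and coefficients are
    contractive. *)
Lemma symbol_vanishing F T (e : R) : A T -> symb F T -> 0 < e ->
  exists K, forall k, (K <= k)%N -> rnorm (F k) < e.
Proof.
move=> AT FT e0; have /(semicrossed_approx phi dotp_norm sigma_rep)/(_ _ e0)[s hs] := AT.
have [G [N [Gs G0]]] := polynomial_symbol phi dotp_norm sigma_rep s.
exists N => k Nk; have := symbol_contractive dotp_norm sigma_rep k (symbolB sigma_rep FT Gs).
by rewrite G0// subr0 => /le_lt_trans; apply.
Qed.

Definition cesaro N n : R := (N - n)%:R / N%:R.

(** Fejer's inequality. The operator with coefficients [(1 - n/N)^+ F n] is the
    average over the windows of [N] consecutive coordinates of the compressions
    of [T] to a window: the entry (i, k) of [T] is seen by [N - (i - k)]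
    windows. Each coordinate lies in [N] windows, which bounds the sum of the
    compressions by [N] times the norm of [T]. *)
Lemma cesaro_contractive N F T W : (0 < N)%N -> symb F T ->
  symb (fun n => (cesaro N n)%:C *: F n) W -> rnorm W <= rnorm T.
Proof.
move=> N0 FT GW; have Np : 0 < N%:R :> R by rewrite ltr0n.
apply: BL_rnorm_le => [|v]; first exact: rnorm_ge0.
apply: l2_rnorm_le => [|m]; first by rewrite mulr_ge0 ?rnorm_ge0.
pose w r : l2 H := \sum_(k < r.+1) (if (r < k + N)%N then tensor (v k) k else 0).
have wE r k : w r k = if (k <= r < k + N)%N then v k else 0.
  rewrite /w l2_sumE; have [kr|rk] := leqP k r; last first.
    rewrite big1// => j _; case: ifP => // _; rewrite tensorE.
    by case: eqP => // E; move: rk; rewrite E ltnNge -ltnS ltn_ord.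
  have kr1 : (k < r.+1)%N by [].
  rewrite (bigD1 (Ordinal kr1))// big1 /= ?addr0; first by case: ifP => //= _; rewrite eqxx.
  move=> j; rewrite -val_eqE /= eq_sym => /negbTE jk; case: ifP => //= _.
  by rewrite jk.
have key i : N%:R%:C *: W v i = \sum_(j < N) T (w (i + j)%N) i.
  rewrite (symbolE _ _ GW) scaler_sumr.
  under [RHS]eq_bigr do rewrite (symbolE _ _ FT).
  rewrite exchange_big /=; apply: eq_bigr => k _.
  have ki : (k <= i)%N by rewrite -ltnS ltn_ord.
  rewrite alphaZ (rep_scale sigma_rep) BL_scaleE scalerA -rmorphM /=.
  rewrite /cesaro mulrCA divff ?gt_eqF// mulr1.
  rewrite (eq_bigr (fun j : 'I_N => if (j < N - (i - k))%N then
      sigma (alpha k (F (i - k)%N)) (v k) else 0)); last first.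
    move=> j _; rewrite wE (leq_trans ki (leq_addr _ _)) andTb.
    have -> : (i + j < k + N)%N = (j < N - (i - k))%N.
      by rewrite ltn_subRL -{1}(subnKC ki) -addnA ltn_add2l.
    by case: ifP => // _; rewrite BL0.
  rewrite sum_prefix ?leq_subr//.
  by rewrite rmorph_nat scaler_nat.
have wnorm r M : (r < M)%N ->
    rnorm (w r) ^+ 2 <= \sum_(k < M) if (k <= r < k + N)%N then rnorm (v k) ^+ 2 else 0.
  move=> rM; apply: l2_rnorm_sqr_le => n.
  pose b k : R := if (k <= r < k + N)%N then rnorm (v k) ^+ 2 else 0.
  have b0 k : 0 <= b k by rewrite /b; case: ifP => // _; exact: sqr_ge0.
  apply: (@le_trans _ _ (\sum_(k < M + n) b k)).
    rewrite addnC big_split_ord /= -[leLHS]addr0 lerD ?sumr_ge0//.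
    apply: ler_sum => k _; rewrite wE /b.
    by case: ifP => // _; rewrite rnorm0 expr0n.
  rewrite big_split_ord /= [X in _ + X]big1 ?addr0// => k _.
  by rewrite /b [(_ <= r)%N]leqNgt (leq_trans rM) ?leq_addr.
have step i : (i < m)%N -> N%:R * rnorm (W v i) ^+ 2 <=
    \sum_(r < m + N) rnorm (T (w r) i) ^+ 2.
  move=> im; rewrite -(ler_pM2l Np) mulrA -expr2 -exprMn.
  have -> : N%:R * rnorm (W v i) = rnorm (N%:R%:C *: W v i).
    by rewrite rnormZ rnorm_real ger0_norm// ltW.
  rewrite key; apply: (@le_trans _ _ ((\sum_(j < N) rnorm (T (w (i + j)%N) i)) ^+ 2)).
    by rewrite ler_sqr ?nnegrE ?rnorm_ge0 ?sumr_ge0 ?rnorm_sum// => j _; exact: rnorm_ge0.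
  apply: le_trans (sqr_sum_le _ (fun j => rnorm (T (w (i + j)%N) i))) _.
  rewrite ler_pM2l//; apply: (@sum_shift_le _ (fun r => rnorm (T (w r) i) ^+ 2)).
    by move=> k; exact: sqr_ge0.
  exact: ltnW.
rewrite -(ler_pM2l Np) mulr_sumr.
apply: (@le_trans _ _ (\sum_(i < m) \sum_(r < m + N) rnorm (T (w r) i) ^+ 2)).
  by apply: ler_sum => i _; exact: step.
rewrite exchange_big /=.
apply: (@le_trans _ _ (\sum_(r < m + N) rnorm T ^+ 2 * \sum_(k < m + N)
    if (k <= r < k + N)%N then rnorm (v k) ^+ 2 else 0)).
  apply: ler_sum => r _; apply: le_trans (l2_psum_ub _ _) _.
  apply: (@le_trans _ _ (rnorm T ^+ 2 * rnorm (w r) ^+ 2)).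
    by rewrite -exprMn ler_sqr ?nnegrE ?mulr_ge0 ?rnorm_ge0// BL_rnorm_ub.
  by rewrite ler_wpM2l ?sqr_ge0// wnorm.
rewrite -mulr_sumr exprMn mulrCA ler_wpM2l ?sqr_ge0//.
rewrite exchange_big /=; apply: (@le_trans _ _ (\sum_(k < m + N) N%:R * rnorm (v k) ^+ 2)).
  by apply: ler_sum => k _; apply: sum_window_le; exact: sqr_ge0.
by rewrite -mulr_sumr ler_wpM2l ?ler0n// l2_psum_ub.
Qed.

Definition fejer N F : BL (l2 H) := \sum_(n < N) U n ((cesaro N n)%:C *: F n).

Lemma symbol_fejer N F : symb (fun n => (cesaro N n)%:C *: F n) (fejer N F).
Proof.
have := symbol_sum sigma_rep (index_enum 'I_N)
  (fun n : 'I_N => symbol_monomial phi dotp_norm sigma_rep n ((cesaro N n)%:C *: F n)).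
congr symbol; apply/funext => n.
have [Nn|nN] := leqP N n.
  rewrite big1 => [|i _]; last first.
    by case: eqP => // ni; have := ltn_ord i; rewrite -ni ltnNge Nn.
  by rewrite /cesaro (eqP (_ : (N - n)%N == 0)%N) ?subn_eq0// mul0r scale0r.
rewrite (bigD1 (Ordinal nN)) //= eqxx big1 ?addr0// => i.
by rewrite -val_eqE /= eq_sym => /negbTE ->.
Qed.

(** Cesaro means converge on polynomials, and are uniformly contractive. *)
Lemma fejer_approx F T (e : R) : A T -> symb F T -> 0 < e ->
  exists N, rnorm (T - fejer N F) < e.
Proof.
move=> AT FT e0; have e3 : 0 < e / 3 by rewrite divr_gt0.
have E : e / 3 + (e / 3 + e / 3) <= e by lra.
have /(semicrossed_approx phi dotp_norm sigma_rep)/(_ _ e3)[s hs] := AT.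
have [G [M [Gs G0]]] := polynomial_symbol phi dotp_norm sigma_rep s.
pose K : R := \sum_(n < M) rnorm (G n).
have K0 : 0 <= K by apply: sumr_ge0 => n _; exact: rnorm_ge0.
have MK0 : 0 <= M%:R * K / (e / 3) by rewrite divr_ge0 ?mulr_ge0 ?ler0n// ltW.
have [N [N0 MN NK]] : exists N, [/\ (0 < N)%N, (M <= N)%N & M%:R * K / N%:R <= e / 3].
  exists (M + Num.truncn (M%:R * K / (e / 3))).+1; split=> //.
    by rewrite leqW// leq_addr.
  rewrite ler_pdivrMr ?ltr0n// [leRHS]mulrC -ler_pdivrMr// ltW//.
  by apply: (lt_le_trans (truncnS_gt _)); rewrite ler_nat ltnS leq_addl.
have Np : 0 < N%:R :> R by rewrite ltr0n.
exists N.
have h1 : rnorm (fejer N F - fejer N G) <= rnorm (T - P s).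
  apply: (@cesaro_contractive N _ _ _ _ (symbolB sigma_rep FT Gs)) => //.
  have := symbolB sigma_rep (symbol_fejer N F) (symbol_fejer N G).
  by congr symbol; apply/funext => n; rewrite scalerBr.
have h2 : rnorm (P s - fejer N G) <= e / 3.
  have D := symbolB sigma_rep Gs (symbol_fejer N G).
  rewrite (symbol_polynomial dotp_norm sigma_rep (N := M) D); last first.
    by move=> n /G0 ->; rewrite scaler0 subrr.
  apply: le_trans (rnorm_sum _ _ _) _; apply: le_trans NK.
  rewrite /K mulr_sumr mulr_suml; apply: ler_sum => n _.
  apply: le_trans (monomial_rnorm _ _ _ _ _) _.
  have nN : (n <= N)%N := leq_trans (ltnW (ltn_ord n)) MN.
  rewrite -{1}(scale1r (G n)) -scalerBl.
  have -> : 1 - (cesaro N n)%:C = (n%:R / N%:R)%:C :> R[i].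
    rewrite -[1]/(1%:C : R[i]) -rmorphB /= /cesaro natrB//; congr _%:C.
    by field; rewrite gt_eqF.
  rewrite rnormZ rnorm_real ger0_norm ?divr_ge0 ?ler0n// mulrAC.
  rewrite ler_wpM2r ?invr_ge0 ?ler0n// ler_wpM2r ?rnorm_ge0// ler_nat.
  exact: ltnW (ltn_ord n).
apply: le_lt_trans (rnorm_tri T (P s) (fejer N F)) _.
apply: lt_le_trans E.
apply: ltr_leD; first exact: hs.
apply: le_trans (rnorm_tri (P s) (fejer N G) (fejer N F)) _.
apply: lerD; first exact: h2.
rewrite (rnormB (fejer N G) (fejer N F)).
apply: le_trans h1 _.
exact: (ltW hs).
Qed.

End semicrossed_algebra.

(** * Compact elements have vanishing coefficients *)

Section recurrence.
Context {R : realType} {X : metricType R} (phi : homeomorphism X).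

Lemma iter_homeo_continuous n : continuous (iter n phi).
Proof.
elim: n => [|n IH] x /=; first exact: cvg_id.
by apply: continuous_comp; [exact: IH|exact: homeo_fun_continuous].
Qed.

Lemma wandering_iter k x : wandering_points phi (iter k phi x) ->
  wandering_points phi x.
Proof.
move=> [V [Vo Vx] Vw]; exists (iter k phi @^-1` V).
  split=> //; apply: open_comp => // y _; exact: iter_homeo_continuous.
move=> p q /= p0 q0 [z /= [pz qz]]; apply: (@addnI k).
apply: Vw => /=; [by rewrite addn_gt0 p0 orbT|by rewrite addn_gt0 q0 orbT|].
by exists z; split=> /=; rewrite iterD.
Qed.

(** A periodic point returns along multiples of its period. Another point has
    neighbourhoods disjoint from their first images, so its returns come late. *)
Lemma nonwandering_recurrence x (V : set X) M :
  ~ wandering_points phi x -> nbhs x V ->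
  exists y d, [/\ (M <= d)%N, V y & V (iter d phi y)].
Proof.
move=> xw xV.
have [[p p0 px]|nper] := pselect (exists2 p, (0 < p)%N & iter p phi x = x).
  exists x, (M * p)%N; split; [exact: leq_pmulr|exact: nbhs_singleton|].
  have -> : iter (M * p) phi x = x; last exact: nbhs_singleton.
  by elim: M => // M IH; rewrite mulSn iterD IH.
have [W [Wo Wx WV Wd]] : exists W, [/\ open W, W x, W `<=` V &
    forall y d, (0 < d < M)%N -> W y -> ~ W (iter d phi y)].
  elim: M => [|M [W [Wo Wx WV Wd]]].
    exists (interior V); split; [exact: open_interior|exact: xV|exact: interior_subset|].
    by move=> y d; rewrite ltn0 andbF.
  have [->|M0] := posnP M; first by exists W; split=> // y [|d].
  have xM : x != iter M phi x by apply/eqP => E; apply: nper; exists M.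
  have := @metric_hausdorff _ X; rewrite open_hausdorff => /(_ _ _ xM).
  move=> [[P Q] /= [/set_mem Px /set_mem Qx] [Po Qo PQ]].
  exists (W `&` (P `&` iter M phi @^-1` Q)); split=> //.
  - apply: openI => //; apply: openI => //.
    by apply: open_comp => // y _; exact: iter_homeo_continuous.
  - by move=> y [/WV].
  move=> y d /andP[d0]; rewrite ltnS leq_eqVlt => /orP[/eqP ->|dM] [Wy [Py Qy]] [Wd' [Pd _]].
    by have : (P `&` Q) (iter M phi y); [split|rewrite (eqP PQ)].
  by apply: (Wd y d) => //; rewrite d0.
apply: contrapT => h; apply: xw; exists W => // p q /= p0 q0 [z [/= pz qz]].
have aux a b : (a < b)%N -> W (iter a phi z) -> W (iter b phi z) -> False.
  move=> ab aW bW; have ba : iter b phi z = iter (b - a) phi (iter a phi z).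
    by rewrite -iterD subnK// ltnW.
  apply: h; exists (iter a phi z), (b - a)%N; split; [|exact: WV|].
    rewrite leqNgt; apply/negP => baM.
    have ab0 : (0 < b - a < M)%N by rewrite subn_gt0 ab.
    by apply: (Wd _ _ ab0 aW); rewrite -ba.
  by rewrite -ba; exact: WV.
by have [/aux/(_ pz qz)|/aux/(_ qz pz)|] := ltngtP p q.
Qed.

End recurrence.

(** Moving each centre of a net to a nearby point of [S], when there is one, at
    most doubles the distances. *)
Lemma precompact_inner_net (R : realType) (V : normedModType R[i]) (S : set V) :
  precompact S -> forall e : R, 0 < e ->
  exists s : seq V, (forall y, y \in s -> S y) /\
    forall x, S x -> exists2 y, y \in s & rnorm (x - y) < e.
Proof.
move=> Sc e e0; have e2 : 0 < e / 2 by rewrite divr_gt0.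
have [s hs] := precompact_net Sc e2.
suff [t tS ht] : exists2 t : seq V, (forall y, y \in t -> S y) &
    forall x z, S x -> z \in s -> rnorm (x - z) < e / 2 ->
      exists2 y, y \in t & rnorm (x - y) < e.
  by exists t; split=> // x Sx; have [z zs xz] := hs x Sx; exact: ht zs xz.
elim: s {hs} => [|z s [t tS ht]]; first by exists [::].
have [[y Sy yz]|nz] := pselect (exists2 y, S y & rnorm (y - z) < e / 2).
  exists (y :: t) => [w|x w Sx]; first by rewrite inE => /predU1P[->|/tS].
  rewrite inE => /predU1P[-> xz|ws xw]; last first.
    by have [v vt xv] := ht x w Sx ws xw; exists v; rewrite // inE vt orbT.
  exists y; first by rewrite mem_head.
  apply: le_lt_trans (rnorm_tri x z y) _; rewrite (splitr e).
  by apply: ltrD; rewrite // rnormB.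
exists t => // x w Sx; rewrite inE => /predU1P[-> xz|ws xw]; last exact: ht ws xw.
by case: nz; exists x.
Qed.

Section sandwich.
Context {R : realType} {X : topologicalType} {phi : homeomorphism X}.
Context {H : normedModType R[i]} {dotp : {dot H for Num.conj}}.
Context (dotp_norm : forall x : H, `|x| ^+ 2 = dotp x x).
Context {sigma : C0 R X -> BL H}.
Context (sigma_rep : faithful_representation dotp sigma).
Implicit Types (f g : C0 R X) (F G : nat -> C0 R X) (T : BL (l2 H)).

Local Notation alpha := (alpha phi).
Local Notation symb := (@symbol R X phi H sigma).
Local Notation A := (semicrossed_product phi sigma).
Local Notation U := (Umonomial phi dotp_norm sigma_rep).

Lemma convolution_monomiall m f F :
  convolution phi (fun n => if n == m then f else 0) F =
  fun k => if (m <= k)%N then C0_mul (alpha (k - m) f) (F (k - m)%N) else 0.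
Proof.
apply/funext => k; rewrite /convolution; have [mk|km] := leqP m k.
  have mk1 : (k - m < k.+1)%N by rewrite ltnS leq_subr.
  rewrite (bigD1 (Ordinal mk1)) //= subKn// eqxx big1 ?addr0// => j.
  rewrite -val_eqE /= => jkm; case: eqP => [E|_].
    by case/eqP: jkm; rewrite -E subKn// -ltnS ltn_ord.
  by apply: C0_ext => x; rewrite /= mul0r.
rewrite big1// => j _; case: eqP => [E|_].
  by have := leq_subr j k; rewrite E leqNgt km.
by apply: C0_ext => x; rewrite /= mul0r.
Qed.

Lemma convolution_monomialr m f F :
  convolution phi F (fun n => if n == m then f else 0) =
  fun k => if (m <= k)%N then C0_mul (alpha m (F (k - m)%N)) f else 0.
Proof.
apply/funext => k; rewrite /convolution; have [mk|km] := leqP m k.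
  have mk1 : (m < k.+1)%N by [].
  rewrite (bigD1 (Ordinal mk1)) //= eqxx big1 ?addr0// => j.
  rewrite -val_eqE /= => /negbTE ->.
  by apply: C0_ext => x; rewrite /= mulr0.
rewrite big1// => j _; case: eqP => [jm|_].
  by have := ltn_ord j; rewrite ltnS jm leqNgt km.
by apply: C0_ext => x; rewrite /= mulr0.
Qed.

Lemma symbol_sandwich F T m f : symb F T ->
  exists2 G, symb G (BL_comp T (BL_comp (U m f) T)) &
    forall k x, G (m + k)%N x = \sum_(j < k.+1)
      F (k - j)%N (iter (m + j) phi x) * (f (iter j phi x) * F j x).
Proof.
move=> FT; have M := symbol_monomial phi dotp_norm sigma_rep m f.
eexists; first exact: (symbol_comp sigma_rep FT (symbol_comp sigma_rep M FT)).
move=> k x; rewrite convolution_monomiall /convolution.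
rewrite C0_sumE -addnS big_split_ord /= big1 ?add0r; last first.
  by move=> j _; rewrite leqNgt ltn_ord /= mulr0.
apply: eq_bigr => j _; rewrite /= leq_addr addKn /=.
by rewrite subnDl.
Qed.

(** The elements of the net are taken in the algebra, so that they have Fourier
    coefficients. *)
Lemma compact_element_net T (B : set (C0 R X)) (M e : R) :
  compact_element A T -> (forall f, B f -> rnorm f <= M) -> 0 < e ->
  exists s : seq (BL (l2 H)), (forall S, S \in s -> A S) /\
    forall m f, B f -> exists2 S, S \in s &
      rnorm (BL_comp T (BL_comp (U m f) T) - S) < e.
Proof.
move=> [AT Tc] BM e0.
pose Z := [set S | exists m f, B f /\ S = U m f].
have ZA : Z `<=` A by move=> _ [m [f [_ ->]]]; exact: monomial_mem.
have Zb : bounded_set Z.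
  apply/bounded_rnormP; exists M => _ [m [f [/BM fM ->]]].
  exact: le_trans (monomial_rnorm _ _ _ _ _) fM.
have [s [sZ hs]] := precompact_inner_net (Tc Z ZA Zb) e0.
exists s; split=> [_ /sZ[S /ZA AS <-]|m f Bf].
  by apply: semicrossed_comp => //; apply: semicrossed_comp.
by apply: hs; exists (U m f) => //; exists m, f.
Qed.

(** The coefficients of the members of a finite net vanish eventually, hence so do
    those of all [T (U^m f) T], uniformly in [m]. *)
Lemma compact_element_vanishing T f (e : R) : compact_element A T -> 0 < e ->
  exists K, forall m k G, symb G (BL_comp T (BL_comp (U m f) T)) ->
    (K <= k)%N -> rnorm (G k) < e.
Proof.
move=> Tc e0; have e2 : 0 < e / 2 by rewrite divr_gt0.
have [|s [sA hs]] := @compact_element_net T [set f] (rnorm f) (e / 2) Tc _ e2.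
  by move=> _ ->.
have [K hK] : exists K, forall S G k, S \in s -> symb G S -> (K <= k)%N ->
    rnorm (G k) < e / 2.
  elim: s sA {hs} => [|S s IH] sA; first by exists 0%N.
  have [|K hK] := IH; first by move=> S' S's; apply: sA; rewrite inE S's orbT.
  have AS : A S by apply: sA; rewrite mem_head.
  have [F FS] := semicrossed_symbol dotp_norm sigma_rep AS.
  have [L hL] := symbol_vanishing dotp_norm sigma_rep AS FS e2.
  exists (maxn K L) => S' G k; rewrite inE geq_max => /predU1P[->|S's] GS /andP[Kk Lk].
    by rewrite -(symbol_unique sigma_rep FS GS); exact: hL.
  exact: hK S's GS Kk.
exists K => m k G GT Kk; have [S Ss TS] := hs m f erefl.
have [F FS] := semicrossed_symbol dotp_norm sigma_rep (sA _ Ss).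
have h1 := hK S F k Ss FS Kk.
have h2 := le_lt_trans (symbol_contractive dotp_norm sigma_rep k (symbolB sigma_rep GT FS)) TS.
rewrite (splitr e); apply: le_lt_trans (rnorm_leD (G k) (F k)) _.
exact: ltrD.
Qed.

(** The zeroth coefficients of [T f T] form a precompact family of functions when
    [f] runs over a ball, hence an equicontinuous one. *)
Lemma compact_element_equicontinuous T (M e : R) x : compact_element A T -> 0 < e ->
  \forall y \near x, forall f G, rnorm f <= M ->
    symb G (BL_comp T (BL_comp (U 0 f) T)) -> rnorm (G 0%N x - G 0%N y) < e.
Proof.
move=> Tc e0; have e3 : 0 < e / 3 by rewrite divr_gt0.
have [//|s [sA hs]] := @compact_element_net T [set f | rnorm f <= M] M (e / 3) Tc _ e3.
have : \forall y \near x, forall S G, S \in s -> symb G S ->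
    rnorm (G 0%N x - G 0%N y) < e / 3.
  elim: s sA {hs} => [|S s IH] sA; first by apply: nearW.
  have AS : A S by apply: sA; rewrite mem_head.
  have [F FS] := semicrossed_symbol dotp_norm sigma_rep AS.
  have sA' S' : S' \in s -> A S' by move=> S's; apply: sA; rewrite inE S's orbT.
  have /cvg_rnormP/(_ _ e3) := (C0P (F 0%N)).1 x.
  apply: filterS2 (IH sA') => y IHy Fy S' G; rewrite inE => /predU1P[->|S's] GS.
    by rewrite -(symbol_unique sigma_rep FS GS).
  exact: IHy S's GS.
apply: filterS => y hy f G fM GT; have [S Ss TS] := hs 0%N f fM.
have [F FS] := semicrossed_symbol dotp_norm sigma_rep (sA _ Ss).
have h1 := hy S F Ss FS.
have h2 := le_lt_trans (symbol_contractive dotp_norm sigma_rep 0%N (symbolB sigma_rep GT FS)) TS.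
have hx : rnorm (G 0%N x - F 0%N x) < e / 3 := le_lt_trans (C0_rnorm_ub (G 0%N - F 0%N) x) h2.
have hyy : rnorm (F 0%N y - G 0%N y) < e / 3.
  by rewrite rnormB; exact: le_lt_trans (C0_rnorm_ub (G 0%N - F 0%N) y) h2.
have -> : e = e / 3 + (e / 3 + e / 3) by field.
apply: le_lt_trans (rnorm_tri _ (F 0%N x) _) _; apply: ltrD => //.
apply: le_lt_trans (rnorm_tri _ (F 0%N y) _) _; exact: ltrD.
Qed.

End sandwich.

Section metric_cutoffs.
Context {R : realType} {X : metricType R}.
Implicit Types (x y z : X).

Lemma nbhs_mdistE x (V : set X) :
  nbhs x V -> exists2 r : R, 0 < r & forall y, mdist x y < r -> V y.
Proof.
move=> /nbhs_ballP[r /= r0 rV]; exists r => // y xy.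
by apply: rV; rewrite ballEmdist.
Qed.

Lemma mdist_continuousr x : continuous (fun z => mdist x z).
Proof.
move=> z; apply/cvgrPdist_lt => e e0; apply/nbhs_ballP; exists e => // y.
rewrite ballEmdist /= => zy; apply: le_lt_trans zy.
rewrite ler_norml; apply/andP; split.
  by have := metric_triangle x z y; lra.
by have := metric_triangle x y z; rewrite (metric_sym y z); lra.
Qed.

(** Multiplying [f] by a tent function localizes it near [x]. *)
Lemma C0_localize (f : C0 R X) x (r : R) : 0 < r ->
  exists2 g : C0 R X, g x = f x & forall y, g y != 0 -> mdist x y < r.
Proof.
move=> r0; pose u z : R := Num.max 0 (1 - mdist x z / r).
have uc : continuous u.
  move=> z; apply: (@continuous_max _ _ (cst 0) (fun z => 1 - mdist x z / r)).
    exact: cvg_cst.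
  apply: cvgB; first exact: cvg_cst.
  by apply: cvgM; [exact: mdist_continuousr|exact: cvg_cst].
have u1 z : `|u z| <= 1.
  rewrite ger0_norm ?le_max ?lexx// ge_max ler01 /=.
  by rewrite lerBlDr lerDl divr_ge0 ?mdist_ge0 ?ltW.
exists (MkC0 (C0_cut_subproof f uc u1)) => [|y] /=.
  by rewrite /u mdistxx mul0r subr0 (max_idPr ler01) mul1r.
apply: contraNT; rewrite -leNgt => ry; rewrite /u (max_idPl _) ?mul0r//.
by rewrite subr_le0 ler_pdivlMr// mul1r.
Qed.

(** The cut-off is min 1 (d(-, y) / d(x, y)). *)
Lemma C0_separate (f : C0 R X) x y : x != y ->
  exists2 g : C0 R X, rnorm g <= rnorm f & g x = f x /\ g y = 0.
Proof.
rewrite -mdist_gt0 => d0; pose u z : R := Num.min 1 (mdist y z / mdist x y).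
have uc : continuous u.
  move=> z; apply: (@continuous_min _ _ (cst 1) (fun z => mdist y z / mdist x y)).
    exact: cvg_cst.
  by apply: cvgM; [exact: mdist_continuousr|exact: cvg_cst].
have u1 z : `|u z| <= 1.
  rewrite ger0_norm ?ge_min ?lexx// le_min ler01 /=.
  by rewrite divr_ge0 ?mdist_ge0 ?ltW.
exists (MkC0 (C0_cut_subproof f uc u1)).
  apply: C0_rnorm_le => [|z]; first exact: rnorm_ge0.
  rewrite -[X in rnorm X]/((u z)%:C * f z) rnormM rnorm_real.
  apply: le_trans (C0_rnorm_ub f z).
  by rewrite -[leRHS]mul1r ler_wpM2r ?rnorm_ge0.
split; rewrite /= /u.
  by rewrite (metric_sym y x) divff ?gt_eqF// minxx mul1r.
by rewrite mdistxx mul0r (min_idPr ler01) mul0r.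
Qed.

End metric_cutoffs.

Lemma near_bounded_forall (T : topologicalType) (x : T) N (P : nat -> T -> Prop) :
  (forall i, (i < N)%N -> \forall y \near x, P i y) ->
  \forall y \near x, forall i, (i < N)%N -> P i y.
Proof.
elim: N => [|N IH] h; first by apply: nearW.
apply: filterS2 (IH _) (h N (ltnSn N)) => [y Py PN i|i iN]; last exact: h (ltnW _).
by rewrite ltnS leq_eqVlt => /predU1P[->|/Py].
Qed.

Section compact_elements.
Context {R : realType} {X : metricType R} {phi : homeomorphism X}.
Context {H : normedModType R[i]} {dotp : {dot H for Num.conj}}.
Context (dotp_norm : forall x : H, `|x| ^+ 2 = dotp x x).
Context {sigma : C0 R X -> BL H}.
Context (sigma_rep : faithful_representation dotp sigma).
Implicit Types (f g : C0 R X) (F G : nat -> C0 R X) (T S : BL (l2 H)).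

Local Notation alpha := (alpha phi).
Local Notation symb := (@symbol R X phi H sigma).
Local Notation A := (semicrossed_product phi sigma).
Local Notation U := (Umonomial phi dotp_norm sigma_rep).

(** The zeroth coefficient of [T f T] is (F 0)^2 f. For [f] equal to [F 0] at [x]
    and to 0 at a nearby point [y], it takes the values (F 0 x)^3 and 0: this
    contradicts equicontinuity unless F 0 x = 0. *)
Lemma compact_accumulation F T x : compact_element A T -> symb F T ->
  accumulation_points x -> F 0%N x = 0.
Proof.
move=> Tc FT xa; apply/eqP/negP => /negP Fx.
have a0 : 0 < rnorm (F 0%N x) ^+ 3 by rewrite exprn_gt0// rnorm_gt0.
have [y [yx _ hy]] :=
  xa _ (@compact_element_equicontinuous _ _ phi _ _ dotp_norm _ sigma_rep T
    (rnorm (F 0%N)) _ x Tc a0).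
have xy : x != y by rewrite eq_sym.
have [f fF [fx fy]] := C0_separate (F 0%N) xy.
have [G GT GE] := symbol_sandwich dotp_norm sigma_rep 0 f FT.
have := hy f G fF GT.
rewrite -[0%N]/(0 + 0)%N !GE !big_ord_recl !big_ord0 /= !addr0.
by rewrite fx fy mul0r mulr0 subr0 !rnormM -expr2 -exprS ltxx.
Qed.

(** Take the least [n] for which the coefficient [F n] does not vanish on the
    forward orbit of the nonwandering point, and a point [z] of the orbit where
    it does not vanish. If [y] and [phi^d y] are near [z], where [d] is large,
    and [m = d - n], the coefficient of index [m + 2 n] of [T (U^m f) T] at [y]
    is the sum over i + j = 2 n of products of [F i] at [phi^(m + j) y] and [F j]
    at [y]. Unless i = j = n one of the two factors is small by minimality, so
    the sum is bounded away from 0 as [d] grows; precompactness forbids this.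
    The function [f] is the translate of [F n] by [phi^(-n)], so that its factor
    is again [F n y] in the term i = j = n. *)
Lemma compact_nonwandering F T x n : compact_element A T -> symb F T ->
  ~ wandering_points phi x -> F n x = 0.
Proof.
move=> Tc FT xw; apply/eqP/negP => /negP; move: n => n0 Fx.
have [n [k Fnk] nmin] : exists2 n, exists k, F n (iter k phi x) != 0 &
    forall j, (j < n)%N -> forall l, F j (iter l phi x) = 0.
  have ex : exists n, `[< exists k, F n (iter k phi x) != 0 >].
    by exists n0; apply/asboolP; exists 0%N.
  case: (ex_minnP ex) => p /asboolP pP pmin; exists p => // j jp l.
  apply/eqP/negP => /negP Fj; move: jp; rewrite ltnNge pmin//.
  by apply/asboolP; exists l.
set z := iter k phi x in Fnk.
have zw : ~ wandering_points phi z by move=> /wandering_iter.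
have zmin j l : (j < n)%N -> F j (iter l phi z) = 0.
  by move=> jn; rewrite /z -iterD nmin.
pose psi := Homeomorphism (homeo_invK phi) (homeo_funK phi)
  (@homeo_inv_continuous _ phi) (@homeo_fun_continuous _ phi).
pose f := Defs.alpha psi n (F n).
have fE y : f (iter n phi y) = F n y.
  rewrite /f /=; congr (F n _).
  by elim: (n) y => // p IH y; rewrite iterSr iterS homeo_funK IH.
(* The term i = j = n exceeds c^3 = 2 e; each of the at most N other terms is at
   most B d, and d is chosen so that they add up to at most e. *)
pose c := rnorm (F n z) / 2; have c0 : 0 < c by rewrite divr_gt0// rnorm_gt0.
pose B := rnorm f * \sum_(j < n.*2.+1) rnorm (F j).
have B0 : 0 <= B by rewrite mulr_ge0 ?rnorm_ge0 ?sumr_ge0// => j _; exact: rnorm_ge0.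
have FB j : (j < n.*2.+1)%N -> rnorm f * rnorm (F j) <= B.
  move=> jn; rewrite ler_wpM2l ?rnorm_ge0// (bigD1 (Ordinal jn))//= lerDl.
  by apply: sumr_ge0 => i _; exact: rnorm_ge0.
pose N : R := n.*2.+1%:R; have N0 : 0 < N by rewrite ltr0n.
pose e := c ^+ 3 / 2; have e0 : 0 < e by rewrite divr_gt0// exprn_gt0.
have NB0 : 0 < N * (B + 1) by rewrite mulr_gt0// ltr_wpDl.
pose d := e / (N * (B + 1)); have d0 : 0 < d by rewrite divr_gt0.
have NBd : N * (B * d) <= e.
  have -> : e = N * (B + 1) * d by rewrite /d mulrCA divff ?mulr1// gt_eqF.
  by rewrite -mulrA ler_pM2l// ler_pM2r// lerDl.
have near1 : \forall y \near z, c < rnorm (F n y).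
  have := @rnorm_C0_continuous _ _ (F n) z; move/cvgrPdist_lt => /(_ c c0).
  by apply: filterS => y /ltr_normlW; rewrite /c; lra.
have near2 : \forall y \near z, forall i, (i < n)%N -> forall l, (l < n.+1)%N ->
    rnorm (F i (iter l phi y)) < d.
  apply: near_bounded_forall => i ni; apply: near_bounded_forall => l _.
  have Fc : {for z, continuous (fun y => rnorm (F i (iter l phi y)))}.
    apply: (@continuous_comp _ _ _ (iter l phi) (fun y => rnorm (F i y))).
      exact: iter_homeo_continuous.
    exact: rnorm_C0_continuous.
  move/cvgrPdist_lt: Fc => /(_ d d0); apply: filterS => y.
  by rewrite zmin// rnorm0 sub0r normrN ger0_norm// rnorm_ge0.
have [K hK] := @compact_element_vanishing _ _ phi _ _ dotp_norm _ sigma_rep T f _ Tc e0.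
have [y [p [Kp [y1 y2] [w1 w2]]]] :=
  nonwandering_recurrence (K + n) zw (filterI near1 near2).
have np : (n <= p)%N := leq_trans (leq_addl K n) Kp.
pose m := (p - n)%N; have pE : p = (m + n)%N by rewrite subnK.
have [G GT GE] := symbol_sandwich dotp_norm sigma_rep m f FT.
have Km : (K <= m + n.*2)%N.
  by rewrite -(leq_add2r n) (leq_trans Kp)// pE leq_add2r leq_addr.
have small := le_lt_trans (C0_rnorm_ub (G (m + n.*2)%N) y) (hK _ _ _ GT Km).
have nn : (n < n.*2.+1)%N by rewrite ltnS -addnn leq_addr.
pose t (j : nat) : R[i]^o :=
  F (n.*2 - j)%N (iter (m + j) phi y) * (f (iter j phi y) * F j y).
have main : c ^+ 3 < rnorm (t n).
  rewrite /t -addnn addnK -pE fE !rnormM exprS expr2.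
  by rewrite !ltr_pM ?mulr_ge0 ?rnorm_ge0// ltW.
have rest : rnorm (\sum_(j < n.*2.+1 | j != Ordinal nn) t j) <= e.
  apply: le_trans NBd; apply: le_trans (rnorm_sum _ _ _) _.
  apply: (@le_trans _ _ (\sum_(j < n.*2.+1) B * d)); last first.
    by rewrite sumr_const card_ord mulr_natl.
  rewrite [leLHS]big_mkcond; apply: ler_sum => j _.
  case: ifP => [jn|_]; last by rewrite mulr_ge0// ltW.
  have fub : rnorm (f (iter j phi y)) <= rnorm f := C0_rnorm_ub f _.
  have [jlt|jge] := ltnP j n.
    have h := y2 j jlt 0%N (ltn0Sn n); rewrite /= in h.
    rewrite /t !rnormM mulrA ler_pM ?mulr_ge0 ?rnorm_ge0 ?(ltW h)//.
    rewrite mulrC (le_trans _ (FB (n.*2 - j)%N _)) ?ltnS ?leq_subr//.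
    by rewrite ler_pM ?rnorm_ge0// C0_rnorm_ub.
  have {jge}nj : (n < j)%N.
    by rewrite ltn_neqAle jge andbT; apply: contra_neq jn => E; apply: val_inj.
  have jn2 : (j <= n.*2)%N by rewrite -ltnS.
  have ilt : (n.*2 - j < n)%N.
    move: nj jn2; move: (nat_of_ord j) => i nj jn2.
    by rewrite ltn_subLR// -addnn ltn_add2r.
  have llt : (j - n < n.+1)%N by rewrite ltnS leq_subLR addnn.
  have := w2 _ ilt _ llt; rewrite -iterD pE addnC -addnA (subnKC (ltnW nj)) => h.
  rewrite /t !rnormM mulrC ler_pM ?mulr_ge0 ?rnorm_ge0 ?(ltW h)//.
  rewrite (le_trans _ (FB j (ltn_ord j)))//.
  by rewrite ler_pM ?rnorm_ge0// C0_rnorm_ub.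
have c3 : c ^+ 3 = e + e by rewrite /e -splitr.
move: rest; set r := \sum_(j < _ | _) t j => rest.
have := lt_le_trans main (rnorm_leD (t n) (t n + r)).
have -> : t n - (t n + r) = - r by rewrite opprD addrA subrr add0r.
rewrite rnormN c3 ltNge => /negP; apply.
apply: lerD rest; rewrite GE (bigD1 (Ordinal nn)) // in small.
exact: (ltW small).
Qed.

End compact_elements.

(** * Compact elements generate *)

Section generation.
Context {R : realType} {X : metricType R} {phi : homeomorphism X}.
Context {H : normedModType R[i]} {dotp : {dot H for Num.conj}}.
Context (dotp_norm : forall x : H, `|x| ^+ 2 = dotp x x).
Context {sigma : C0 R X -> BL H}.
Context (sigma_rep : faithful_representation dotp sigma).
Implicit Types (f g : C0 R X) (F G : nat -> C0 R X) (T S : BL (l2 H)).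

Local Notation alpha := (alpha phi).
Local Notation symb := (@symbol R X phi H sigma).
Local Notation A := (semicrossed_product phi sigma).
Local Notation U := (Umonomial phi dotp_norm sigma_rep).
Local Notation E := (fourier_coef phi sigma).

Lemma fourier_symbol T : A T -> symb (fun n => E n T) T.
Proof.
move=> AT; have [F FT] := semicrossed_symbol dotp_norm sigma_rep AT.
rewrite (_ : (fun n => E n T) = F)//; apply/funext => n.
exact: (symbol_fourier dotp_norm sigma_rep).
Qed.

Lemma symbol_monomial_sandwich F S n g : symb F S ->
  exists2 G, symb G (BL_comp (U n g) (BL_comp S (U n g))) &
    forall k x, G k x = if (n + n <= k)%N then
      g (iter (k - n) phi x) * (F (k - (n + n))%N (iter n phi x) * g x) else 0.
Proof.
move=> FS; have M := symbol_monomial phi dotp_norm sigma_rep n g.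
eexists; first exact: (symbol_comp sigma_rep M (symbol_comp sigma_rep FS M)).
move=> k x; rewrite convolution_monomiall convolution_monomialr.
have [nk|kn] := leqP n k; last by rewrite leqNgt (leq_trans kn (leq_addr _ _)).
rewrite /= leq_subRL// subnDA; case: ifP => //= _.
by rewrite mulr0.
Qed.

Lemma wandering_disjoint (V : set X) x k : wandering_set phi V -> (0 < k)%N ->
  V x -> V (iter k phi x) -> False.
Proof.
move=> Vw k0 Vx Vk; pose z := homeo_inv phi x.
have zx : phi z = x by exact: homeo_invK.
have : 1%N = k.+1 :> nat.
  apply: Vw => //; exists z; split; first by rewrite /= zx.
  by rewrite /preimage /mkset iterSr zx.
by move=> [k00]; rewrite -k00 in k0.
Qed.

(** If [g] lives on a wandering set and [n > 0], then [(U^n g) S (U^n g) = 0]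
    because the set never meets its images. *)
Lemma compact_monomial_wandering n g (V : set X) : (0 < n)%N ->
  wandering_set phi V -> (forall x, g x != 0 -> V x) ->
  compact_element A (U n g).
Proof.
move=> n0 Vw gV; split=> [|B BA _]; first exact: monomial_mem.
apply: (@precompact_line _ _ 0 0) => _ [S /BA /fourier_symbol FS <-].
exists 0; last by rewrite rnorm0.
rewrite scaler0; have [G GS GE] := symbol_monomial_sandwich n g FS.
apply: (symbol_eq GS); rewrite (_ : G = fun=> 0); first exact: (symbol0 phi sigma_rep).
apply/funext => k; apply: C0_ext => x; rewrite GE.
case: leqP => // nk; have [gx|/gV Vx] := eqVneq (g x) 0.
  by rewrite gx !mulr0.
have [->|/gV Vk] := eqVneq (g (iter (k - n) phi x)) 0; first by rewrite mul0r.
have kn : (0 < k - n)%N by rewrite subn_gt0 (leq_trans _ nk)// -addn1 leq_add2l.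
by case: (wandering_disjoint Vw kn Vx Vk).
Qed.

(** Only the zeroth coefficient of [S] contributes to [g S g] when [g] lives at one
    wandering point [x], because [phi] never brings [x] back: [g S g] is a multiple
    of [g]. *)
Lemma compact_monomial_point g x : wandering_points phi x ->
  (forall y, g y != 0 -> y = x) -> compact_element A (U 0 g).
Proof.
move=> [V [Vo Vx] Vw] gx; split=> [|B BA /bounded_rnormP[M BM]].
  exact: monomial_mem.
apply: (@precompact_line _ _ (U 0 g) (M * rnorm g)) => _ [S BS <-].
have FS := fourier_symbol (BA _ BS).
exists (E 0%N S x * g x); last first.
  rewrite rnormM ler_pM ?rnorm_ge0 ?C0_rnorm_ub//.
  apply: le_trans (C0_rnorm_ub _ _) _; apply: le_trans _ (BM _ BS).
  exact: (symbol_contractive dotp_norm sigma_rep 0%N FS).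
have [G GS GE] := symbol_monomial_sandwich 0 g FS.
have ZS := symbolZ sigma_rep (E 0%N S x * g x)
  (symbol_monomial phi dotp_norm sigma_rep 0 g).
apply: (symbol_eq GS); move: ZS; congr symb.
apply/funext => k; apply: C0_ext => y; rewrite GE /= !subn0.
rewrite -[LHS]/((E 0%N S x * g x) * (if k == 0%N then g else 0) y).
have [gy|gy] := eqVneq (g y) 0.
  by rewrite gy !mulr0; case: ifP => _; rewrite ?gy mulr0.
rewrite (gx y gy); case: eqP => [->|/eqP k0] /=; first by rewrite mulrC.
rewrite mulr0; have [->|gk] := eqVneq (g (iter k phi x)) 0; first by rewrite mul0r.
rewrite -lt0n in k0; case: (wandering_disjoint Vw k0 Vx).
by rewrite (gx _ gk).
Qed.

Definition vanishing_ideal : set (BL (l2 H)) :=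
  [set T | [/\ A T,
      forall n x, (~` wandering_points phi) x -> E n T x = 0 &
      forall x, accumulation_points x -> E 0 T x = 0]].

Lemma vanishing_ideal_closed : closed_ideal A vanishing_ideal.
Proof.
have Elin a S T n : A S -> A T -> E n (a *: S + T) = a *: E n S + E n T.
  move=> AS AT; apply: (symbol_fourier dotp_norm sigma_rep (F := fun n => a *: E n S + E n T)).
    exact: (semicrossed_linear dotp_norm sigma_rep).
  exact: (symbolD sigma_rep (symbolZ sigma_rep a (fourier_symbol AS)) (fourier_symbol AT)).
have Ecomp S T n : A S -> A T ->
    E n (BL_comp S T) = convolution phi (fun n => E n S) (fun n => E n T) n.
  move=> AS AT; apply: (symbol_fourier dotp_norm sigma_rep).
    exact: (semicrossed_comp dotp_norm sigma_rep).
  exact: (symbol_comp sigma_rep (fourier_symbol AS) (fourier_symbol AT)).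
have E0 n : E n 0 = 0.
  apply: (symbol_fourier dotp_norm sigma_rep n _ (symbol0 phi sigma_rep)).
  exact: (semicrossed0 dotp_norm sigma_rep).
split.
- by move=> T [].
- apply: closed_rnormP => T hT.
  have AT : A T.
    apply: (@closed_closure _ _); apply/closure_rnormP => e /hT[S [AS _ _] TS].
    by exists S.
  have lim n x : (forall S, vanishing_ideal S -> E n S x = 0) -> E n T x = 0.
    move=> hS; apply: rnorm_small => e /hT[S IS TS]; have [AS _ _] := IS.
    have h := symbol_contractive dotp_norm sigma_rep n
      (symbolB sigma_rep (fourier_symbol AT) (fourier_symbol AS)).
    have -> : E n T x = (E n T - E n S) x.
      by rewrite -[RHS]/(E n T x - E n S x) (hS S IS) subr0.
    apply: le_trans (C0_rnorm_ub _ _) _; apply: le_trans h _; exact: (ltW TS).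
  split=> // [n x xw|x xa]; apply: lim => S [_ h1 h2]; [exact: h1|exact: h2].
- split; first split=> [|n x _|x _]; rewrite ?E0//.
    exact: (semicrossed0 dotp_norm sigma_rep).
  move=> a S T [AS S1 S2] [AT T1 T2]; split=> [|n x xw|x xa].
  + exact: (semicrossed_linear dotp_norm sigma_rep).
  + by rewrite Elin// -[LHS]/(a * E n S x + E n T x) S1// T1// mulr0 addr0.
  + by rewrite Elin// -[LHS]/(a * E 0%N S x + E 0%N T x) S2// T2// mulr0 addr0.
move=> S T AS [AT T1 T2]; split; split.
- exact: (semicrossed_comp dotp_norm sigma_rep).
- move=> n x xw; rewrite Ecomp// C0_sumE big1// => j _.
  by rewrite /= T1// mulr0.
- by move=> x xa; rewrite Ecomp// C0_sumE big_ord1 /= T2// mulr0.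
- exact: (semicrossed_comp dotp_norm sigma_rep).
- move=> n x xw; rewrite Ecomp// C0_sumE big1// => j _.
  by rewrite /= T1 ?mul0r// => /wandering_iter.
- by move=> x xa; rewrite Ecomp// C0_sumE big_ord1 /= T2// mul0r.
Qed.

(** For a closed ideal [J], the functions [f] with [U^n f] in [J] form a closed
    ideal of C_0(X), so that membership can be tested locally. *)
Lemma monomial_local (J : set (BL (l2 H))) n f : closed_ideal A J ->
  (forall x, f x != 0 -> exists2 g, J (U n g) & g x != 0) -> J (U n f).
Proof.
move=> [JA Jcl [J0 JD] JM]; apply: (@C0_closed_ideal _ _ (fun f => J (U n f))).
- by rewrite monomial0.
- by move=> g h Jg Jh; rewrite monomialD -[U n g]scale1r; exact: JD.
- move=> g h Jg; have [_] := JM (U 0 h) (U n g) (@monomial_mem _ _ phi _ _ dotp_norm _ sigma_rep 0 h) Jg.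
  rewrite monomialM addn0; congr (J (U n (C0_mul _ h))).
  by apply: C0_ext.
move=> g hg; apply: Jcl; apply/closure_rnormP => e e0.
have e2 : 0 < e / 2 by rewrite divr_gt0.
have [h Jh gh] := hg _ e2; exists (U n h) => //.
rewrite -monomialB; apply: le_lt_trans (monomial_rnorm _ _ _ _ _) _.
by apply: le_lt_trans gh _; rewrite ltr_pdivrMr// ltr_pMr// ltr1n.
Qed.

(** The Cesaro means of [T] are combinations of monomials [U^n (E n T)]. Near a
    point where [E n T] does not vanish, the cut-off of [E n T] to a wandering
    neighbourhood, or to the point itself if n = 0, gives a compact monomial. *)
Lemma vanishing_ideal_generated (J : set (BL (l2 H))) : closed_ideal A J ->
  compact_element A `<=` J -> vanishing_ideal `<=` J.
Proof.
move=> JI cJ T [AT T1 T2]; have [JA Jcl [J0 JD] JM] := JI.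
apply: Jcl; apply/closure_rnormP => e e0.
have [N hN] := fejer_approx dotp_norm sigma_rep AT (fourier_symbol AT) e0.
exists (fejer (phi := phi) dotp_norm sigma_rep N (fun n => E n T)) => //.
rewrite /fejer; elim/big_ind : _ => // [S S' JS JS'|n _].
  by rewrite -[S]scale1r; exact: JD.
rewrite monomialZ -[X in J X]addr0; apply: JD => //.
apply: monomial_local => // x Tx.
have [V [Vo Vx] Vw] : wandering_points phi x.
  by apply: contrapT => xw; move/eqP: Tx; apply; exact: T1.
have [n0|n0] := posnP n.
  have [r r0 hr] : exists2 r : R, 0 < r & forall y, mdist x y < r -> y = x.
    have xa : ~ accumulation_points x.
      by move=> /T2 Ex; move/eqP: Tx; apply; rewrite n0.
    move/existsNP: xa => [W /not_implyP[xW hW]].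
    have [r r0 rW] := nbhs_mdistE xW; exists r => // y /rW Wy.
    by apply/eqP/negP => /negP yx; apply: hW; exists y.
  have [g gx gr] := C0_localize (E n T) x r0; exists g; last by rewrite gx.
  rewrite n0; apply: cJ; apply: (@compact_monomial_point g x); last first.
    by move=> y /gr/hr.
  by exists V.
have [r r0 rV] := nbhs_mdistE (open_nbhs_nbhs (conj Vo Vx)).
have [g gx gr] := C0_localize (E n T) x r0; exists g; last by rewrite gx.
apply: cJ; apply: (@compact_monomial_wandering n g V) => // y /gr; exact: rV.
Qed.

End generation.

Theorem theorem2p11 (R : realType) (X : metricType R)
    (X_locally_compact : locally_compact [set: X])
    (phi : homeomorphism X)
    (H : completeNormedModType R[i]) (dotp : {dot H for Num.conj})
    (dotp_norm : forall x : H, `|x| ^+ 2 = dotp x x)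
    (sigma : C0 R X -> BL H)
    (sigma_rep : faithful_representation dotp sigma) :
  let A := semicrossed_product phi sigma in
  generated_ideal A (compact_element A) =
  [set T | [/\ A T,
      forall n x, (~` wandering_points phi) x ->
        fourier_coef phi sigma n T x = 0 &
      forall x, accumulation_points x -> fourier_coef phi sigma 0 T x = 0]].
Proof.
move=> A; apply/seteqP; split=> T.
  apply; split; first exact: (vanishing_ideal_closed dotp_norm sigma_rep).
  move=> S Sc; have [AS _] := Sc.
  have FS := fourier_symbol dotp_norm sigma_rep AS.
  split=> // [n x xw|x xa].
    exact: (compact_nonwandering dotp_norm sigma_rep n Sc FS xw).
  exact: (compact_accumulation dotp_norm sigma_rep Sc FS xa).
move=> IT J [JI cJ].
exact: (vanishing_ideal_generated dotp_norm sigma_rep JI cJ IT).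
Qed.
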